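(* There is an absolute constant $\alpha$ such that the following holds. Let $H$ be a graph on $r\ge 3$ vertices, $\varepsilon\in(0,1/2]$, and $\ell=\alpha r^3+\lceil\varepsilon^{-20}\rceil$. If $G$ (with $n$ vertices and maximum degree $d$) is $\varepsilon$-far from $H$-minor-freeness, then the algorithm IsMinorFree$(G,\varepsilon,H)$ outputs REJECT with probability at least $2/3$.
   Context: $G=(V,E)$, $|V|=n$, maximum degree $d$, accessed by neighbor queries. $G$ is $\varepsilon$-far from $H$-minor-freeness if more than $\varepsilon dn$ edge modifications are needed to make it $H$-minor-free. The lazy random walk: from vertex $v$ of degree $d_v$, move to each neighbor with probability $1/(2d)$ and stay at $v$ with probability $1-d_v/(2d)$. Algorithm IsMinorFree$(G,\varepsilon,H)$: (1) pick a multiset $S$ of $\ell^{21}$ uniformly random vertices; (2) for every $s\in S$ run EstClip$(s)$ and LocalSearch$(s)$; (3) if any call to LocalSearch returns FOUND, REJECT; (4) if more than $2\ell^{20}$ calls to EstClip return LOW, REJECT; (5) otherwise ACCEPT. LocalSearch$(s)$: perform $\ell^{21}$ independent lazy random walks of length $\ell^{11}$ from $s$, let $B_s$ be the set of all vertices encountered, determine the induced subgraph $G[B_s]$, and return FOUND iff $G[B_s]$ contains an $H$-minor (decided by an exact minor-finding algorithm). EstClip$(s)$: perform $w=\ell^{14}$ independent lazy random walks of length $\ell$ from $s$; for every vertex $v$ let $w_v$ be the number of walks ending at $v$; let $T=\{v: w_v\ge \ell^7/2\}$; output HIGH if $\sum_{v\in T}w_v\ge w/3$, else LOW.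
   Formalization: H is additionally assumed connected; without this the claim fails, e.g. for H an edge plus an isolated vertex, ε = 1/4 and G a perfect matching on 4 vertices, which is ε-far from H-minor-freeness but never rejected. *)

(* Defs.v *)
From mathcomp Require Import all_boot all_order all_algebra.
From mathcomp Require Import reals.

Set Implicit Arguments.
Unset Strict Implicit.
Unset Printing Implicit Defensive.

Import Order.TTheory GRing.Theory Num.Theory.

Local Open Scope ring_scope.

Record graph (V : finType) := Graph {
  edge :> rel V;
  edge_sym : symmetric edge;
  edge_irrefl : irreflexive edge
}.

Section Graphs.
Context {V : finType}.
Implicit Types (G : graph V) (A : {set V}).

Definition degree G (v : V) : nat := #|[set u | G v u]|.

Definition max_degree G : nat := (\max_(v : V) degree G v)%N.

Definition edge_set G : {set {set V}} :=
  [set e | [exists x, exists y, (e == [set x; y]) && G x y]].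

(* The number of edge modifications (insertions and deletions) turning G
   into G'. *)
Definition edit_distance G G' : nat :=
  #|(edge_set G :\: edge_set G') :|: (edge_set G' :\: edge_set G)|.

Definition connected_in G A : bool :=
  [forall x in A, forall y in A,
    connect [rel u v | [&& u \in A, v \in A & G u v]] x y].

(* Used for the forbidden graph H: both tests of the algorithm are local, so it
   cannot detect an H-minor spread over several components of G. For instance,
   with H the disjoint union of an edge and a vertex, a perfect matching on 4
   vertices is 1/4-far from H-minor-freeness but never rejected. *)
Definition connected_graph G : bool := connected_in G setT.

Definition induced_rel G A : rel {x : V | x \in A} :=
  relpre val (edge G).

Lemma induced_sym G A : symmetric (@induced_rel G A).
Proof. by move=> x y; rewrite /induced_rel /= edge_sym. Qed.

Lemma induced_irrefl G A : irreflexive (@induced_rel G A).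
Proof. by move=> x; rewrite /induced_rel /= edge_irrefl. Qed.

Definition induced G A : graph {x : V | x \in A} :=
  Graph (@induced_sym G A) (@induced_irrefl G A).

End Graphs.

(* G has an H-minor: [phi] assigns to the vertices of H nonempty, connected,
   pairwise disjoint branch sets of G, adjacent whenever the vertices are. *)
Definition has_minor {W V : finType} (H : graph W) (G : graph V) : bool :=
  [exists phi : {ffun W -> {set V}},
    [&& [forall x, (phi x != set0) && connected_in G (phi x)],
        [forall x, forall y, (x != y) ==> [disjoint phi x & phi y]] &
        [forall x, forall y, H x y ==>
          [exists u in phi x, exists v in phi y, G u v]]]].

Definition minor_free {W V : finType} (H : graph W) (G : graph V) : bool :=
  ~~ has_minor H G.

(* G' need not respect the degree bound d; this does not affect the distance,
   since deletions alone achieve it. *)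
Definition far_from_minor_free {R : realType} {W V : finType}
    (eps : R) (d : nat) (H : graph W) (G : graph V) : Prop :=
  forall G' : graph V, minor_free H G' ->
    eps * d%:R * #|V|%:R < (edit_distance G G')%:R.

Section LazyWalk.
Context {V : finType} (R : realType).
Variables (d : nat) (G : graph V).

Definition lazy_step (u v : V) : R :=
  if v == u then 1 - (degree G u)%:R / (2 * d%:R)
  else if G u v then 1 / (2 * d%:R) else 0.

(* The probability that the lazy walk started at s successively visits the
   vertices listed in p; the start is not listed, so that the walks of length
   L from s are indexed by [L.-tuple V]. *)
Fixpoint walk_prob (s : V) (p : seq V) : R :=
  if p is v :: p' then lazy_step s v * walk_prob v p' else 1.

End LazyWalk.

Section Algorithm.
Context {V W : finType}.
Variables (d l : nat) (H : graph W) (G : graph V).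

(* Trajectories of the walks performed by one call to EstClip, resp. to
   LocalSearch. *)
Definition clip_walks : finType := {ffun 'I_(l ^ 14) -> l.-tuple V}.
Definition search_walks : finType := {ffun 'I_(l ^ 21) -> (l ^ 11).-tuple V}.

Definition end_count (s : V) (c : clip_walks) (v : V) : nat :=
  #|[set j | last s (c j) == v]|.

Definition heavy_set (s : V) (c : clip_walks) : {set V} :=
  [set v | (l ^ 7)%:R / 2 <= (end_count s c v)%:R :> rat].

Definition estclip_high (s : V) (c : clip_walks) : bool :=
  (l ^ 14)%:R / 3 <= (\sum_(v in heavy_set s c) end_count s c v)%N%:R :> rat.

Definition encountered (s : V) (b : search_walks) : {set V} :=
  [set v | [exists j, v \in s :: b j]].

Definition localsearch_found (s : V) (b : search_walks) : bool :=
  has_minor H (induced G (encountered s b)).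

(* The random choices of one iteration of the main loop: the sampled vertex s
   and the walks used by EstClip(s) and by LocalSearch(s). *)
Definition iteration : finType := (V * clip_walks * search_walks)%type.

Definition run : finType := {ffun 'I_(l ^ 21) -> iteration}.

Definition rejects (w : run) : bool :=
  [exists i, let: (s, _, b) := w i in localsearch_found s b] ||
  (2 * l ^ 20 < #|[set i | let: (s, c, _) := w i in ~~ estclip_high s c]|)%N.

(* All random choices are independent, except that the walks start at the
   vertex sampled in their iteration. *)
Definition iteration_prob (R : realType) (x : iteration) : R :=
  let: (s, c, b) := x in
  #|V|%:R^-1 * (\prod_j walk_prob R d G s (c j))
             * (\prod_j walk_prob R d G s (b j)).

Definition run_prob (R : realType) (w : run) : R :=
  \prod_i iteration_prob R (w i).

Definition reject_prob (R : realType) : R :=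
  \sum_(w : run | rejects w) run_prob R w.

End Algorithm.

Definition walk_param {R : realType} (alpha r : nat) (eps : R) : nat :=
  (alpha * r ^ 3 + `|Num.ceil (eps ^- 20)|)%N.

(* Main.v *)
(* Let [p_t(x, s)] be the t-step distribution of the lazy walk, [theta] of order
   [l^-7], and [f_x(s) = max(0, p_t(x, s) - theta)]; note [f_x(s) = f_s(x)].
   If EstClip is LOW with probability at least [30 / l], the tester rejects by
   counting. Otherwise, for all but a [60 / l] fraction of the vertices [s],
   walks from [s] are concentrated on few vertices: [\sum_x f_x(s) >= 1/24].
   A clipped entropy of [p_t(x, .)] is non-increasing in [t] and of order
   [log l], so at some common time [t < l] it hardly drops, which makes the total
   variation of the [f_x] along the edges of G a small multiple of [d n]. By the
   coarea formula, as long as more than [eps n / 8] vertices remain, some level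
   set of some [f_x] has few outgoing edges; cutting such level sets off greedily
   partitions almost all of G at the cost of few edges. As G is far from
   H-minor-free and H is connected, pieces containing an H-minor cover at least
   [eps n / 4] vertices. Two vertices of a piece with seed [x] are joined by a
   walk through [x] of length [2 t] with probability at least [theta ^ 2], so
   LocalSearch sees a whole piece, and finds its minor, with probability 1/2. *)
Require Import Defs.
From mathcomp Require Import all_boot all_order all_algebra.
From mathcomp Require Import boolp reals.
From mathcomp Require Import zify ring lra.

Set Implicit Arguments.
Unset Strict Implicit.
Unset Printing Implicit Defensive.

Import Order.TTheory GRing.Theory Num.Theory.

Local Open Scope ring_scope.

(** * Product measures: independent samples from a finite type *)

Section ProductMeasure.
Variables (R : realType) (N : nat) (T : finType) (mu : T -> R).

Definition prod_mass (f : {ffun 'I_N -> T}) : R := \prod_i mu (f i).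

(** Independence of the coordinates amounts to expanding a product of sums. *)
Lemma prod_expectation (g : 'I_N -> T -> R) :
  \sum_(f : {ffun 'I_N -> T}) prod_mass f * \prod_i g i (f i) =
  \prod_i \sum_x mu x * g i x.
Proof.
by rewrite bigA_distr_bigA; apply: eq_bigr => f _; rewrite -big_split.
Qed.

Lemma prod_expectation_pow (g : T -> R) :
  \sum_(f : {ffun 'I_N -> T}) prod_mass f * \prod_i g (f i) =
  (\sum_x mu x * g x) ^+ N.
Proof. by rewrite (prod_expectation (fun=> g)) prodr_const card_ord. Qed.

Hypothesis mu_ge0 : forall x, 0 <= mu x.
Hypothesis mu_sum1 : \sum_x mu x = 1.

Lemma prod_mass_ge0 f : 0 <= prod_mass f.
Proof. exact: prodr_ge0. Qed.

Lemma prod_mass_sum1 : \sum_f prod_mass f = 1.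
Proof.
by rewrite /prod_mass -(bigA_distr_bigA (fun=> mu)) big1.
Qed.

Lemma prod_expectation1 (j : 'I_N) (g : T -> R) :
  \sum_(f : {ffun 'I_N -> T}) prod_mass f * g (f j) = \sum_x mu x * g x.
Proof.
pose h (i : 'I_N) x : R := if i == j then g x else 1.
have hE (f : {ffun 'I_N -> T}) : g (f j) = \prod_i h i (f i).
  by rewrite (bigD1 j)//= /h eqxx big1 ?mulr1// => i /negPf ->.
under eq_bigr => f _ do rewrite hE.
rewrite prod_expectation (bigD1 j)//= [X in _ * X]big1 ?mulr1 /h ?eqxx// => i /negPf ->.
by under eq_bigr => x _ do rewrite mulr1.
Qed.

Lemma prod_expectation2 (j k : 'I_N) (g1 g2 : T -> R) : j != k ->
  \sum_(f : {ffun 'I_N -> T}) prod_mass f * (g1 (f j) * g2 (f k)) =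
  (\sum_x mu x * g1 x) * (\sum_x mu x * g2 x).
Proof.
move=> jk.
pose h (i : 'I_N) x : R := if i == j then g1 x else if i == k then g2 x else 1.
have kj : k != j by rewrite eq_sym.
have hE (f : {ffun 'I_N -> T}) : g1 (f j) * g2 (f k) = \prod_i h i (f i).
  rewrite (bigD1 j)//= (bigD1 k)//= /h eqxx (negPf kj) eqxx big1 ?mulr1//.
  by move=> i /andP[/negPf -> /negPf ->].
under eq_bigr => f _ do rewrite hE.
rewrite prod_expectation (bigD1 j)//= (bigD1 k)//= /h eqxx (negPf kj) eqxx.
rewrite [X in _ * (_ * X)]big1 ?mulr1// => i /andP[/negPf -> /negPf ->].
by under eq_bigr => x _ do rewrite mulr1.
Qed.

Lemma prod_mass_avoid (A : pred T) :
  \sum_(f : {ffun 'I_N -> T} | [forall i, ~~ A (f i)]) prod_mass f =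
  (1 - \sum_(x | A x) mu x) ^+ N.
Proof.
have <- : \sum_x mu x * (~~ A x)%:R = 1 - \sum_(x | A x) mu x.
  rewrite -[X in _ = X - _]mu_sum1 [X in _ = X - _](bigID A)/= addrAC subrr add0r.
  rewrite [RHS]big_mkcond/=; apply: eq_bigr => x _.
  by case: (A x); rewrite ?mulr1 ?mulr0.
rewrite -(prod_expectation_pow (fun x => (~~ A x)%:R)).
rewrite [LHS]big_mkcond/=; apply: eq_bigr => f _.
case: forallP => [Af|nAf].
  by rewrite big1 ?mulr1// => i _; rewrite Af.
have /existsP[i Ai] : [exists i, A (f i)].
  by apply: contra_notT nAf => /existsPn.
by rewrite (bigD1 i)//= Ai mul0r mulr0.
Qed.

(* Chernoff: [E 2^-X] for the number [X] of coordinates in [A]. *)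
Lemma prod_mass_few (A : pred T) (k : nat) :
  \sum_(f : {ffun 'I_N -> T} | (#|[set i | A (f i)]| <= k)%N) prod_mass f <=
  2 ^+ k * (1 - (\sum_(x | A x) mu x) / 2) ^+ N.
Proof.
pose g x : R := if A x then 1 / 2 else 1.
have gE : \sum_x mu x * g x = 1 - (\sum_(x | A x) mu x) / 2.
  rewrite -[X in _ = X - _]mu_sum1 [X in _ = X - _](bigID A)/= [LHS](bigID A)/=.
  rewrite (eq_bigr (fun x => mu x / 2)); last first.
    by move=> x Ax; rewrite /g Ax div1r.
  rewrite [X in _ + X = _](eq_bigr mu); last first.
    by move=> x /negPf Ax; rewrite /g Ax mulr1.
  by rewrite -mulr_suml; lra.
rewrite -gE -prod_expectation_pow mulr_sumr big_mkcond/=.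
have prodg (f : {ffun 'I_N -> T}) :
    \prod_i g (f i) = (1 / 2) ^+ #|[set i | A (f i)]|.
  rewrite -prodr_const [RHS]big_mkcond/=; apply: eq_bigr => i _.
  by rewrite inE /g.
(* Markov: on the event [X <= k], the weight [2 ^ (k - X)] is at least 1. *)
apply: ler_sum => f _; rewrite prodg; case: ifP => [le_k|_]; last first.
  by rewrite !mulr_ge0 ?prod_mass_ge0 ?exprn_ge0 ?divr_ge0.
rewrite mulrCA ler_peMr ?prod_mass_ge0// -(subnK le_k) exprD -mulrA -exprMn.
by rewrite div1r divff ?pnatr_eq0// expr1n mulr1 exprn_ege1// ler1n.
Qed.

End ProductMeasure.

(** A rational substitute for [(1 - y) ^ m <= exp (- m y)]. Its polynomial decay suffices because
    every later use raises it to a further power or needs only a constant. *)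
Lemma expr_compl_le (R : realType) (y : R) (m : nat) : 0 <= y <= 1 ->
  (1 - y) ^+ m * (1 + m%:R * y) <= 1.
Proof.
move=> /andP[y0 y1]; elim: m => [|m IH]; first by rewrite expr0 mul1r mul0r addr0.
have pm : 0 <= (1 - y) ^+ m by rewrite exprn_ge0 ?subr_ge0.
apply: le_trans IH; rewrite exprSr -mulrA ler_wpM2l//.
rewrite -natr1; have : 0 <= m%:R * y * y by rewrite !mulr_ge0.
nra.
Qed.

(** * The lazy walk and its [t]-step distributions *)

Section LazyWalks.
Variables (R : realType) (V : finType) (G : graph V) (d : nat).
Hypothesis max_deg : max_degree G = d.
Hypothesis d_gt0 : (0 < d)%N.

Local Notation P := (lazy_step R d G).

Lemma degree_le v : (degree G v <= d)%N.
Proof. by rewrite -max_deg; apply: (leq_bigmax (F := degree G)). Qed.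

Let dR : 0 < d%:R :> R. Proof. by rewrite ltr0n. Qed.

Lemma sum_neighbours (s : V) (c : R) :
  \sum_(u | G s u) c = (degree G s)%:R * c.
Proof. by rewrite sumr_const /degree cardsE mulr_natl. Qed.

Lemma lazy_step_ge0 u v : 0 <= P u v.
Proof.
rewrite /lazy_step; case: ifP => _; last first.
  by case: ifP => _ //; rewrite divr_ge0 ?mulr_ge0 ?ltW.
rewrite subr_ge0 ler_pdivrMr ?mulr_gt0// mul1r.
have : (degree G u)%:R <= d%:R :> R by rewrite ler_nat degree_le.
by have := dR; lra.
Qed.

Lemma lazy_step_sym u v : P u v = P v u.
Proof.
by rewrite /lazy_step eq_sym edge_sym; case: eqVneq => [->|].
Qed.

(* A lazy step fixes [s] with probability [1 - deg s / d] and otherwise moves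
   along a half-edge with probability 1/2. *)
Lemma lazy_step_sum (s : V) (q : V -> R) :
  \sum_u P s u * q u =
  (1 - (degree G s)%:R / d%:R) * q s +
  \sum_(u | G s u) d%:R^-1 * ((q s + q u) / 2).
Proof.
rewrite (bigD1 s)//= /lazy_step eqxx.
rewrite (eq_bigr (fun u => if G s u then 1 / (2 * d%:R) * q u else 0)); last first.
  by move=> u /negPf us; rewrite us; case: ifP => // _; rewrite mul0r.
rewrite -big_mkcondr/= (eq_bigl (G s)); last first.
  by move=> u; case: eqVneq => //= ->; rewrite edge_irrefl.
have -> : \sum_(u | G s u) d%:R^-1 * ((q s + q u) / 2) =
    \sum_(u | G s u) (d%:R^-1 * q s / 2 + 1 / (2 * d%:R) * q u).
  by apply: eq_bigr => u _; field; rewrite gt_eqF.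
rewrite big_split/= sum_neighbours.
by field; rewrite gt_eqF.
Qed.

Lemma lazy_step_sum1 s : \sum_u P s u = 1.
Proof.
under eq_bigr => u _ do rewrite -[P s u]mulr1.
rewrite (lazy_step_sum s (fun=> 1)) sum_neighbours.
by field; rewrite gt_eqF.
Qed.

Fixpoint walk_dist (t : nat) (s v : V) : R :=
  if t is t'.+1 then \sum_u P s u * walk_dist t' u v else (s == v)%:R.

Lemma walk_dist_ge0 t s v : 0 <= walk_dist t s v.
Proof.
elim: t s => [|t IH] s /=; first exact: ler0n.
by apply: sumr_ge0 => u _; rewrite mulr_ge0 ?lazy_step_ge0.
Qed.

Lemma walk_dist_sum1 t s : \sum_v walk_dist t s v = 1.
Proof.
elim: t s => [|t IH] s /=.
  rewrite (bigD1 s)//= eqxx big1 ?addr0// => v /negPf.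
  by rewrite eq_sym => ->.
rewrite exchange_big/= -[RHS](lazy_step_sum1 s); apply: eq_bigr => u _.
by rewrite -mulr_sumr IH mulr1.
Qed.

Lemma walk_dist_le1 t s v : walk_dist t s v <= 1.
Proof.
rewrite -(walk_dist_sum1 t s) (bigD1 v)//= lerDl.
by apply: sumr_ge0 => u _; exact: walk_dist_ge0.
Qed.

Lemma walk_distD t t' s v :
  walk_dist (t + t') s v = \sum_u walk_dist t s u * walk_dist t' u v.
Proof.
elim: t s => [|t IH] s /=.
  rewrite (bigD1 s)//= eqxx mul1r big1 ?addr0// => u /negPf.
  by rewrite eq_sym => ->; rewrite mul0r.
under eq_bigr => u _ do rewrite IH mulr_sumr.
rewrite exchange_big/=; apply: eq_bigr => u _.
by rewrite mulr_suml; apply: eq_bigr => w _; rewrite mulrA.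
Qed.

Lemma walk_dist1 s v : walk_dist 1 s v = P s v.
Proof.
rewrite /= (bigD1 v)//= eqxx mulr1 big1 ?addr0// => u /negPf ->.
by rewrite mulr0.
Qed.

(** Both directions of an edge carry the same probability [1 / (2 d)], so the transition matrix and
    its powers are symmetric. This gives [f_x(s) = f_s(x)]. *)
Lemma walk_dist_sym t s v : walk_dist t s v = walk_dist t v s.
Proof.
elim: t s v => [|t IH] s v; first by rewrite /= eq_sym.
rewrite -[in LHS]addn1 walk_distD [RHS]/=; apply: eq_bigr => u _.
by rewrite walk_dist1 lazy_step_sym IH mulrC.
Qed.

(** With the start [x] fixed, one more step replaces each value by a [P]-average of the old values.
    In this form Jensen's inequality applies. *)
Lemma walk_distS t x s :
  walk_dist t.+1 x s = \sum_u P s u * walk_dist t x u.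
Proof.
by rewrite walk_dist_sym; apply: eq_bigr => u _; rewrite walk_dist_sym.
Qed.

Lemma sum_tupleS (n : nat) (F : n.+1.-tuple V -> R) :
  \sum_(p : n.+1.-tuple V) F p = \sum_v \sum_(p : n.-tuple V) F [tuple of v :: p].
Proof.
rewrite pair_bigA/= (reindex (fun vp : V * n.-tuple V => [tuple of vp.1 :: vp.2]))//=.
exists (fun p => (thead p, [tuple of behead p])) => [[v p] _|p _] /=.
  by congr pair; apply/val_inj.
by rewrite [RHS]tuple_eta.
Qed.

Lemma walk_prob_ge0 s (p : seq V) : 0 <= walk_prob R d G s p.
Proof.
by elim: p s => [|v p IH] s //=; rewrite mulr_ge0 ?lazy_step_ge0.
Qed.

Lemma walk_prob_sum1 n s : \sum_(p : n.-tuple V) walk_prob R d G s p = 1.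
Proof.
elim: n s => [|n IH] s.
  rewrite (eq_bigr (fun=> 1)); first by rewrite sumr_const card_tuple expn0.
  by move=> p _; rewrite tuple0.
rewrite sum_tupleS -[RHS](lazy_step_sum1 s); apply: eq_bigr => v _.
by rewrite -mulr_sumr IH mulr1.
Qed.

(** In [s :: p] position 0 is the start, so position [k] is the vertex after [k] steps; the steps
    after time [k] sum out to 1. *)
Lemma walk_prob_nth n k s v : (k <= n)%N ->
  \sum_(p : n.-tuple V) walk_prob R d G s p * (nth s (s :: p) k == v)%:R =
  walk_dist k s v.
Proof.
elim: k n s => [|k IH] n s.
  by move=> _ /=; rewrite -mulr_suml walk_prob_sum1 mul1r.
case: n => // n le_kn; rewrite sum_tupleS [RHS]/=; apply: eq_bigr => u _.
rewrite -(IH n u le_kn) mulr_sumr; apply: eq_bigr => p _ /=.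
rewrite -mulrA; congr (_ * (_ * (_ == v)%:R)).
case: k {IH} le_kn => //= k le_kn.
by apply: set_nth_default; rewrite size_tuple.
Qed.

Lemma walk_prob_last n s v :
  \sum_(p : n.-tuple V) walk_prob R d G s p * (last s p == v)%:R =
  walk_dist n s v.
Proof.
rewrite -(walk_prob_nth s v (leqnn n)); apply: eq_bigr => p _.
by have := nth_last s (s :: p); rewrite /= size_tuple => ->.
Qed.

Lemma walk_prob_visit n k s v : (k <= n)%N ->
  walk_dist k s v <=
  \sum_(p : n.-tuple V | v \in s :: p) walk_prob R d G s p.
Proof.
move=> le_kn; rewrite -(walk_prob_nth s v le_kn) [leRHS]big_mkcond/=.
apply: ler_sum => p _; case: eqP => [<-|_]; last first.
  by rewrite mulr0; case: ifP; rewrite ?walk_prob_ge0.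
by rewrite mulr1 mem_nth//= size_tuple.
Qed.

End LazyWalks.

(** * Convexity through supporting lines, and a clipped entropy *)

Section Convexity.
Variable R : realType.
Implicit Types (phi : R -> R) (a b p x y : R).

(** Convexity stated by supporting lines: it yields Jensen directly, passes to sums, and is checked
    for piecewise functions without derivatives. *)
Definition has_tangents phi :=
  forall x, exists m, forall y, phi x + m * (y - x) <= phi y.

Definition midpoint_gap phi a b := (phi a + phi b) / 2 - phi ((a + b) / 2).

Lemma midpoint_gap_ge0 phi a b : has_tangents phi -> 0 <= midpoint_gap phi a b.
Proof.
move=> /(_ ((a + b) / 2))[m tm]; rewrite /midpoint_gap.
by have := tm a; have := tm b; lra.
Qed.

Lemma has_tangents_sum (I : finType) (F : I -> R -> R) :
  (forall i, has_tangents (F i)) -> has_tangents (fun p => \sum_i F i p).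
Proof.
move=> tF x; have /fin_all_exists[m tm] i := tF i x.
exists (\sum_i m i) => y; rewrite mulr_suml -big_split/=.
by apply: ler_sum => i _; exact: tm.
Qed.

Lemma midpoint_gap_sum (I : finType) (F : I -> R -> R) a b :
  midpoint_gap (fun p => \sum_i F i p) a b = \sum_i midpoint_gap (F i) a b.
Proof. by rewrite /midpoint_gap -big_split/= mulr_suml -sumrB. Qed.

Definition excess (theta p : R) : R := Num.max 0 (p - theta).

Lemma excess_ge0 theta p : 0 <= excess theta p.
Proof. by rewrite /excess le_max lexx. Qed.

Lemma excess_gt0 theta p : (0 < excess theta p) = (theta < p).
Proof. by rewrite /excess lt_max ltxx subr_gt0. Qed.

Lemma excess_tangents theta : has_tangents (excess theta).
Proof.
move=> x; case: (lerP x theta) => xt.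
  exists 0 => y; rewrite mul0r addr0 {1}/excess max_l ?subr_le0//.
  exact: excess_ge0.
exists 1 => y; rewrite {1}/excess max_r; last by rewrite subr_ge0 ltW.
by rewrite /excess le_max; apply/orP; right; lra.
Qed.

(** The Huber function: a parabola of second derivative [2 / tau] up to [tau], continued by its
    tangent there. It stays convex and grows only linearly. *)
Definition huber (tau p : R) : R :=
  if p <= tau then p ^+ 2 / tau else 2 * p - tau.

Lemma huber_tangents tau : 0 < tau -> has_tangents (huber tau).
Proof.
move=> tau0 x; rewrite /huber; case: (lerP x tau) => xt.
  exists (2 * x / tau) => y.
  have -> : x ^+ 2 / tau + 2 * x / tau * (y - x) =
    (x ^+ 2 + 2 * x * (y - x)) / tau by ring.
  case: (lerP y tau) => yt; rewrite ler_pdivrMr// ?divfK ?gt_eqF//.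
    by have := sqr_ge0 (y - x); lra.
  have := mulr_ge0 (ltW (_ : 0 < y - tau)) (_ : 0 <= tau - x).
  by have := sqr_ge0 (tau - x); rewrite subr_gt0 subr_ge0 => ? /(_ yt xt); lra.
exists 2 => y; case: (lerP y tau) => yt; last by lra.
by rewrite ler_pdivlMr//; have := sqr_ge0 (y - tau); lra.
Qed.

Lemma huber_bounds tau p : 0 < tau -> 0 <= p -> 0 <= huber tau p <= 2 * p.
Proof.
move=> tau0 p0; rewrite /huber; case: (lerP p tau) => pt; apply/andP; split.
- by rewrite divr_ge0 ?sqr_ge0 ?ltW.
- by rewrite ler_pdivrMr//; nra.
- by lra.
- by lra.
Qed.

Lemma huber_gap tau a b : 0 < tau -> a <= tau -> b <= tau ->
  midpoint_gap (huber tau) a b = (a - b) ^+ 2 / (4 * tau).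
Proof.
move=> tau0 at_ bt; rewrite /midpoint_gap /huber at_ bt ifT; last by lra.
by field; rewrite gt_eqF.
Qed.

(* Up to constants this is [p * ln (p / theta)]: the scale [theta * 2 ^ j]
   closest to [p] contributes a second derivative of order [1 / p]. *)
Definition dyadic_entropy (theta : R) (J : nat) (p : R) : R :=
  \sum_(j < J.+1) huber (theta * 2 ^+ j) p.

Lemma dyadic_entropy_tangents theta J : 0 < theta ->
  has_tangents (dyadic_entropy theta J).
Proof.
move=> t0; apply: has_tangents_sum => j; apply: huber_tangents.
by rewrite mulr_gt0// exprn_gt0.
Qed.

Lemma dyadic_entropy_bounds theta J p : 0 < theta -> 0 <= p ->
  0 <= dyadic_entropy theta J p <= 2 * J.+1%:R * p.
Proof.
move=> t0 p0.
have hb (j : 'I_J.+1) := huber_bounds (mulr_gt0 t0 (exprn_gt0 j (ltr0Sn R 1))) p0.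
apply/andP; split; first by apply: sumr_ge0 => j _; case/andP: (hb j).
apply: (@le_trans _ _ (\sum_(j < J.+1) 2 * p)).
  by apply: ler_sum => j _; case/andP: (hb j).
by rewrite sumr_const card_ord -[leLHS]mulr_natl mulrCA mulrA.
Qed.

(** Only the case [theta < a], [b < a] matters. The Huber term at a scale [tau] comparable to [a]
    has midpoint gap [(a - b) ^+ 2 / (4 * tau)], and AM-GM trades this square for [a - b] at the
    price [mu * a]. *)
Lemma excess_gap theta J mu a b :
  0 < theta -> 0 < mu -> 1 <= theta * 2 ^+ J -> 0 <= a <= 1 -> 0 <= b ->
  Num.max 0 (excess theta a - excess theta b) <=
  2 / mu * midpoint_gap (dyadic_entropy theta J) a b + mu * (a + b).
Proof.
move=> t0 mu0 tJ /andP[a0 a1] b0.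
have gap0 := midpoint_gap_ge0 a b (dyadic_entropy_tangents J t0).
have rhs0 : 0 <= 2 / mu * midpoint_gap (dyadic_entropy theta J) a b + mu * (a + b).
  apply: addr_ge0; apply: mulr_ge0 => //; last exact: addr_ge0.
    by rewrite divr_ge0 ?ltW.
  exact: ltW.
rewrite ge_max rhs0/=.
case: (lerP a theta) => a_t.
  apply: le_trans rhs0; rewrite subr_le0 {1}/excess max_l ?excess_ge0//.
  by rewrite subr_le0.
case: (lerP a b) => ab.
  apply: le_trans rhs0; rewrite subr_le0 /excess ge_max le_max lexx/=.
  by rewrite le_max; apply/orP; right; lra.
have lhs : excess theta a - excess theta b <= a - b.
  rewrite {1}/excess max_r; last by rewrite subr_ge0 ltW.
  have : b - theta <= excess theta b by rewrite /excess le_max lexx orbT.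
  by lra.
apply: (le_trans lhs).
(* The least scale above [a] is at most [2 * a]: by minimality if [j > 0], and by [theta < a] if
   [j = 0]. *)
have exj : exists j, a <= theta * 2 ^+ j by exists J; apply: le_trans tJ.
case: (ex_minnP exj) => j aj jmin.
have j_J : (j < J.+1)%N by rewrite ltnS jmin// (le_trans a1).
set tau := theta * 2 ^+ j in aj.
have tau0 : 0 < tau by rewrite mulr_gt0 ?exprn_gt0.
have tau_2a : tau <= 2 * a.
  rewrite /tau; have [->|j0] := posnP j; first by rewrite expr0; lra.
  have : theta * 2 ^+ j.-1 < a.
    by rewrite ltNge; apply/negP => /jmin; rewrite leqNgt prednK ?leqnn.
  by rewrite -[in leLHS](prednK j0) exprS; lra.
have gap_j : (a - b) ^+ 2 / (4 * tau) <= midpoint_gap (dyadic_entropy theta J) a b.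
  rewrite midpoint_gap_sum (bigD1 (Ordinal j_J))//= huber_gap//; last exact: le_trans (ltW ab) aj.
  rewrite lerDl; apply: sumr_ge0 => i _; apply: midpoint_gap_ge0.
  by apply: huber_tangents; rewrite mulr_gt0 ?exprn_gt0.
clearbody tau.
(* AM-GM for [a - b] and [mu * tau], whose remainder [mu * tau / 2] is at most [mu * a]. *)
have AMGM : a - b <= 2 / mu * ((a - b) ^+ 2 / (4 * tau)) + mu * a.
  have -> : 2 / mu * ((a - b) ^+ 2 / (4 * tau)) + mu * a =
     ((a - b) ^+ 2 + 2 * mu ^+ 2 * tau * a) / (2 * mu * tau).
    by field; rewrite !gt_eqF.
  rewrite ler_pdivlMr ?mulr_gt0 ?mulr_gt0//.
  have : 0 <= (a - b - mu * tau) ^+ 2 by exact: sqr_ge0.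
  have : 0 <= mu ^+ 2 * tau * (2 * a - tau).
    by rewrite mulr_ge0 ?subr_ge0// mulr_ge0 ?sqr_ge0// ltW.
  by lra.
apply: (le_trans AMGM); rewrite lerD//; first by rewrite ler_wpM2l ?divr_ge0// ltW.
by rewrite ler_wpM2l ?lerDl// ltW.
Qed.

End Convexity.

(** * Entropy loss of the walk and variation along edges *)

Section LazyWalkVariation.
Variables (R : realType) (V : finType) (G : graph V) (d : nat).
Hypothesis max_deg : max_degree G = d.
Hypothesis d_gt0 : (0 < d)%N.

Local Notation P := (lazy_step R d G).
Local Notation walk_dist := (walk_dist R G d).

Let dR : 0 < d%:R :> R. Proof. by rewrite ltr0n. Qed.

(** Jensen for the decomposition of a lazy step into half-edges: average the tangent at the mean
    [y]; its linear terms cancel. *)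
Lemma lazy_step_convex (phi : R -> R) (q : V -> R) s : has_tangents phi ->
  phi (\sum_u P s u * q u) <=
  (1 - (degree G s)%:R / d%:R) * phi (q s) +
  \sum_(u | G s u) d%:R^-1 * phi ((q s + q u) / 2).
Proof.
move=> /(_ (\sum_u P s u * q u))[m tm].
set y := \sum_u P s u * q u in tm *.
have yE := lazy_step_sum G d_gt0 s q; rewrite -/y in yE.
clearbody y.
have w0 : 0 <= 1 - (degree G s)%:R / d%:R :> R.
  by rewrite subr_ge0 ler_pdivrMr// mul1r ler_nat degree_le.
apply: le_trans (lerD (ler_wpM2l w0 (tm (q s))) (ler_sum _ (fun u _ =>
  ler_wpM2l _ (tm ((q s + q u) / 2))))); last by rewrite invr_ge0 ltW.
rewrite le_eqVlt; apply/orP; left; apply/eqP.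
have -> : \sum_(u | G s u) d%:R^-1 * (phi y + m * ((q s + q u) / 2 - y)) =
  \sum_(u | G s u) d%:R^-1 * (phi y - m * y) +
  m * \sum_(u | G s u) d%:R^-1 * ((q s + q u) / 2).
  by rewrite mulr_sumr -big_split/=; apply: eq_bigr => u _; ring.
have -> : \sum_(u | G s u) d%:R^-1 * ((q s + q u) / 2) =
    y - (1 - (degree G s)%:R / d%:R) * q s by rewrite yE; ring.
rewrite sum_neighbours; ring.
Qed.

Lemma sum_half_edges (q : V -> R) :
  \sum_s \sum_(u | G s u) q u = \sum_s (degree G s)%:R * q s.
Proof.
under eq_bigr => s _ do rewrite big_mkcond/=.
rewrite exchange_big/=; apply: eq_bigr => s _; rewrite -big_mkcond/=.
by rewrite -sum_neighbours; apply: eq_bigl => u; rewrite edge_sym.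
Qed.

(** Summed over [s], replacing each midpoint value by the mean of the two endpoint values would
    restore [\sum_s phi (q s)] exactly, by double counting edges. The midpoint gaps are therefore a
    guaranteed loss. *)
Lemma lazy_step_energy (phi : R -> R) (q : V -> R) : has_tangents phi ->
  \sum_s phi (\sum_u P s u * q u) +
  d%:R^-1 * \sum_s \sum_(u | G s u) midpoint_gap phi (q s) (q u) <=
  \sum_s phi (q s).
Proof.
move=> tphi.
apply: le_trans (lerD (ler_sum _ (fun s _ => lazy_step_convex q s tphi)) (lexx _)) _.
rewrite le_eqVlt; apply/orP; left; apply/eqP.
rewrite mulr_sumr -big_split/=.
have -> : \sum_s phi (q s) = \sum_s ((1 - (degree G s)%:R / d%:R) * phi (q s) +
    d%:R^-1 * ((degree G s)%:R * phi (q s))).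
  by apply: eq_bigr => s _; ring.
rewrite [RHS]big_split/=.
have -> : \sum_s d%:R^-1 * ((degree G s)%:R * phi (q s)) =
    \sum_s \sum_(u | G s u) d%:R^-1 * ((phi (q s) + phi (q u)) / 2).
  under [RHS]eq_bigr => s _ do rewrite -mulr_sumr -mulr_suml big_split/= sum_neighbours.
  rewrite -!mulr_sumr -mulr_suml big_split/= sum_half_edges; lra.
rewrite -big_split/=; apply: eq_bigr => s _.
rewrite -addrA; congr (_ + _); rewrite mulr_sumr -big_split/=.
by apply: eq_bigr => u _; rewrite /midpoint_gap; ring.
Qed.

Lemma walk_dist_convex (phi : R -> R) t t' x : has_tangents phi -> (t <= t')%N ->
  \sum_s phi (walk_dist t' x s) <= \sum_s phi (walk_dist t x s).
Proof.
move=> tphi /subnK <-; elim: (t' - t)%N => [|k IH]; first by rewrite add0n.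
apply: le_trans IH; rewrite addSn.
under eq_bigr => s _ do rewrite walk_distS//.
apply: le_trans (lazy_step_energy (walk_dist (k + t) x) tphi).
rewrite lerDl; apply: mulr_ge0; first by rewrite invr_ge0 ltW.
apply: sumr_ge0 => s _.
by apply: sumr_ge0 => u _; exact: midpoint_gap_ge0.
Qed.

Definition total_drop (q : V -> R) : R :=
  \sum_s \sum_(u | G s u) Num.max 0 (q s - q u).

(** Sum [excess_gap] over directed edges: the gaps are paid by the entropy loss, and the [mu] terms
    total at most [2 * mu * d] since [q] has mass 1 and degrees are at most [d]. *)
Lemma excess_drop_le theta J mu t x :
  0 < theta -> 0 < mu -> 1 <= theta * 2 ^+ J ->
  total_drop (fun s => excess theta (walk_dist t x s)) <=
  d%:R * (2 / mu * (\sum_s dyadic_entropy theta J (walk_dist t x s) -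
                    \sum_s dyadic_entropy theta J (walk_dist t.+1 x s)) + 2 * mu).
Proof.
move=> t0 mu0 tJ; set q := walk_dist t x.
have q0 s : 0 <= q s by exact: walk_dist_ge0.
have q1 s : q s <= 1 by exact: walk_dist_le1.
have qD : \sum_s (degree G s)%:R * q s <= d%:R.
  rewrite -[leRHS]mulr1 -[X in _ <= _ * X](walk_dist_sum1 R G d_gt0 t x) mulr_sumr.
  by apply: ler_sum => s _; rewrite ler_wpM2r ?q0// ler_nat degree_le.
have := lazy_step_energy q (dyadic_entropy_tangents J t0).
under eq_bigr => s _ do rewrite /q -walk_distS//.
set A := \sum_s dyadic_entropy theta J (walk_dist t.+1 x s).
set B := \sum_s dyadic_entropy theta J (q s).
set g := \sum_s _ => AgB.
have {AgB} gAB : g <= d%:R * (B - A).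
  have : d%:R^-1 * g <= B - A by lra.
  by rewrite ler_pdivrMl.
apply: (@le_trans _ _ (2 / mu * g + mu * (2 * d%:R))).
  rewrite /total_drop.
  apply: (@le_trans _ _ (\sum_s \sum_(u | G s u)
     (2 / mu * midpoint_gap (dyadic_entropy theta J) (q s) (q u) + mu * (q s + q u)))).
    apply: ler_sum => s _; apply: ler_sum => u _.
    by apply: excess_gap; rewrite ?q0 ?q1.
  under eq_bigr => s _ do rewrite big_split/= -!mulr_sumr.
  rewrite big_split/= -!mulr_sumr lerD2l; apply: ler_wpM2l; first exact: ltW.
  under eq_bigr => s _ do rewrite big_split/= sum_neighbours.
  rewrite big_split/= sum_half_edges; lra.
have : 2 / mu * g <= 2 / mu * (d%:R * (B - A)) by rewrite ler_wpM2l// divr_ge0// ltW.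
lra.
Qed.

(** Pigeonhole over time: the entropy summed over all starts begins at no more than
    [2 * J.+1 * #|V|] and stays nonnegative, so one of its [l] telescoping losses is at most the
    average. The same [t] serves all [x]. *)
Lemma exists_small_drop theta J mu (l : nat) :
  0 < theta -> 0 < mu -> 1 <= theta * 2 ^+ J -> (0 < l)%N ->
  exists2 t, (t < l)%N &
  \sum_x total_drop (fun s => excess theta (walk_dist t x s)) <=
  d%:R * #|V|%:R * (4 * J.+1%:R / (mu * l%:R) + 2 * mu).
Proof.
move=> t0 mu0 tJ l0.
pose A t := \sum_x \sum_s dyadic_entropy theta J (walk_dist t x s).
have lR : 0 < l%:R :> R by rewrite ltr0n.
have A_ge0 t : 0 <= A t.
  apply: sumr_ge0 => x _; apply: sumr_ge0 => s _.
  by case/andP: (dyadic_entropy_bounds J t0 (walk_dist_ge0 R max_deg d_gt0 t x s)).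
have A0 : A 0%N <= 2 * J.+1%:R * #|V|%:R.
  apply: (@le_trans _ _ (\sum_(x : V) 2 * J.+1%:R)); last first.
    by rewrite sumr_const -[leLHS]mulr_natr.
  apply: ler_sum => x _; rewrite -[leRHS]mulr1.
  rewrite -[X in _ <= _ * X](walk_dist_sum1 R G d_gt0 0 x) mulr_sumr; apply: ler_sum => s _.
  by case/andP: (dyadic_entropy_bounds J t0 (walk_dist_ge0 R max_deg d_gt0 0 x s)).
have [t tl At] : exists2 t, (t < l)%N &
    A t - A t.+1 <= 2 * J.+1%:R * #|V|%:R / l%:R.
  have [/existsP[t At]|] := boolP [exists t : 'I_l,
      A t - A t.+1 <= 2 * J.+1%:R * #|V|%:R / l%:R]; first by exists t.
  move=> /existsPn nA.
  have : \sum_(t < l) (2 * J.+1%:R * #|V|%:R / l%:R) < \sum_(t < l) (A t - A t.+1).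
    apply: ltr_sum; last by move=> t _; rewrite ltNge nA.
    by apply/hasP; exists (Ordinal l0); rewrite ?mem_index_enum.
  have -> : \sum_(t < l) (A t - A t.+1) = A 0%N - A l.
    elim: (l) => [|k IH]; first by rewrite big_ord0 subrr.
    by rewrite big_ord_recr/= IH; ring.
  rewrite sumr_const card_ord -[X in X < _]mulr_natr divfK ?gt_eqF//.
  by have := A_ge0 l; lra.
exists t => //.
apply: le_trans (ler_sum _ (fun x _ => excess_drop_le t x t0 mu0 tJ)) _.
rewrite -mulr_sumr -mulrA ler_pM2l// big_split/= -mulr_sumr sumrB.
rewrite sumr_const -/(A t) -/(A t.+1) -[_ *+ #|_|]mulr_natl.
rewrite [leRHS]mulrDr lerD2r.
have -> : #|V|%:R * (4 * J.+1%:R / (mu * l%:R)) =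
   2 / mu * (2 * J.+1%:R * #|V|%:R / l%:R) :> R.
  by field; rewrite !gt_eqF.
by rewrite ler_wpM2l// divr_ge0 ?ltW.
Qed.

End LazyWalkVariation.

(** * Coarea inequality and greedy partition into sparse cuts *)

Section Partition.
Variables (R : realType) (V : finType) (G : graph V).
Implicit Types (U C : {set V}) (h : V -> R).

Definition out_edges U C : {set V * V} :=
  [set e | [&& e.1 \in C, e.2 \in U :\: C & G e.1 e.2]].

Definition level U h (tau : R) : {set V} := [set s in U | tau < h s].

Lemma card_out_edges U C : C \subset U ->
  #|out_edges U C|%:R =
  \sum_(s in U) \sum_(u in U | G s u) ((s \in C) && (u \notin C))%:R :> R.
Proof.
move=> CU; rewrite -sum1_card natr_sum.
under [RHS]eq_bigr => s _ do rewrite big_mkcondr/=.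
rewrite pair_big/= big_mkcond [RHS]big_mkcond/=; apply: eq_bigr => -[s u] _ /=.
rewrite !inE/=; case sC: (s \in C) => /=; last by case: ifP => // _; case: ifP.
rewrite (subsetP CU _ sC)/=; case: (u \in C) => /=; first by do 2?case: ifP.
by case: (u \in U); case: (G s u).
Qed.

(* Summation by layers; each step of the induction peels off the bottom layer. *)
Lemma coarea_le U h (rho : R) : (forall s, 0 <= h s) ->
  (forall tau, 0 <= tau ->
     rho * #|level U h tau|%:R <= #|out_edges U (level U h tau)|%:R) ->
  rho * \sum_(s in U) h s <=
  \sum_(s in U) \sum_(u in U | G s u) Num.max 0 (h s - h u).
Proof.
(* Induction on the size of the support of [h] in [U]. *)
move: {2}(#|level U h 0|) (leqnn #|level U h 0|) => n.
elim: n h => [|n IH] h supp_n h0 lev.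
  rewrite big1 ?mulr0; last first.
    move=> s sU; apply/eqP; rewrite eq_le h0 andbT leNgt; apply/negP => hs.
    by move: supp_n; rewrite leqn0 cards_eq0 => /eqP/setP/(_ s); rewrite !inE sU hs.
  by do 2!apply: sumr_ge0 => ? _; rewrite le_max lexx.
have [/eqP|[s0 s0C]] := set_0Vmem (level U h 0).
  by rewrite -cards_eq0 => /eqP c0; apply: IH => //; rewrite c0.
set C := level U h 0 in supp_n s0C.
have CE s : (s \in C) = (s \in U) && (0 < h s) by rewrite inE.
have [s1 s1C s1min] : exists2 s1, s1 \in C & forall s, s \in C -> h s1 <= h s.
  by case: (arg_minP h s0C) => s1 ? ?; exists s1.
set m := h s1 in s1min.
have m0 : 0 < m by move: s1C; rewrite CE => /andP[].
pose h' s := Num.max 0 (h s - m).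
have hE s : s \in U -> h s = h' s + m * (s \in C)%:R.
  move=> sU; rewrite /h'; have [sC|sC] := boolP (s \in C).
    by rewrite mulr1 max_r ?subrK// subr_ge0 s1min.
  have -> : h s = 0.
    by apply/eqP; rewrite eq_le h0 andbT leNgt; apply: contra sC; rewrite CE sU.
  by rewrite mulr0 addr0 max_l// sub0r oppr_le0 ltW.
have lev' tau : 0 <= tau -> level U h' tau = level U h (tau + m).
  move=> tau0; apply/setP => s; rewrite !inE /h' lt_max ltrBrDr.
  by rewrite (ltNge tau 0) tau0.
(* Subtracting the bottom layer, of height [m] on [C], lowers the variation by exactly [m] per edge
   leaving [C], as [h'] vanishes on the rest of [U]. *)
have max_split s u : s \in U -> u \in U -> Num.max 0 (h s - h u) =
    Num.max 0 (h' s - h' u) + m * ((s \in C) && (u \notin C))%:R.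
  move=> sU uU; rewrite (hE s sU) (hE u uU).
  have h'0 v : 0 <= h' v by rewrite /h' le_max lexx.
  have h'C v : v \in U -> v \notin C -> h' v = 0.
    move=> vU vC; rewrite /h' max_l// subr_le0; apply: le_trans (ltW m0).
    by rewrite leNgt; apply: contra vC; rewrite CE vU.
  case sC: (s \in C); case uC: (u \in C) => /=.
  - by rewrite mulr1 mulr0 addr0 opprD addrACA subrr addr0.
  - rewrite !mulr1 mulr0 addr0 (h'C u) ?uC// !subr0.
    by rewrite !max_r ?addr_ge0// ltW.
  - rewrite mulr0 mulr1 !addr0 (h'C s) ?sC// !max_l// sub0r oppr_le0//.
    by rewrite addr_ge0// ltW.
  - by rewrite !mulr0 !addr0.
have CU : C \subset U by apply/subsetP => s; rewrite CE => /andP[].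
have -> : \sum_(s in U) h s = \sum_(s in U) h' s + m * #|C|%:R.
  rewrite (eq_bigr (fun s => h' s + m * (s \in C)%:R)) ?big_split//=.
  rewrite -mulr_sumr; congr (_ + m * _); rewrite -sum1_card natr_sum.
  rewrite [LHS]big_mkcond [RHS]big_mkcond/=; apply: eq_bigr => s _.
  have [sC|_] := boolP (s \in C); first by rewrite (subsetP CU).
  by case: ifP.
have -> : \sum_(s in U) \sum_(u in U | G s u) Num.max 0 (h s - h u) =
    \sum_(s in U) \sum_(u in U | G s u) Num.max 0 (h' s - h' u) +
    m * #|out_edges U C|%:R.
  rewrite card_out_edges// mulr_sumr -big_split/=; apply: eq_bigr => s sU.
  rewrite mulr_sumr -big_split/=; apply: eq_bigr => u /andP[uU _].
  exact: max_split.
rewrite mulrDr lerD//; last first.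
  by rewrite mulrCA ler_wpM2l ?(ltW m0)// lev.
apply: IH => [|s|tau tau0]; last 1 first.
- by rewrite lev'// lev// addr_ge0// ltW.
- rewrite -ltnS; apply: leq_trans supp_n; rewrite lev'// add0r.
  (* The support shrinks strictly: the minimiser [s1] drops out. *)
  apply: proper_card; apply/properP; split.
    apply/subsetP => s; rewrite !inE => /andP[-> /=]; exact: lt_trans.
  by exists s1 => //; rewrite inE ltxx andbF.
- by rewrite /h' le_max lexx.
Qed.

Variable f : V -> V -> R.
Hypothesis f_ge0 : forall x s, 0 <= f x s.

Let drop : R := \sum_x \sum_s \sum_(u | G s u) Num.max 0 (f x s - f x u).

(** Otherwise [coarea_le] would hold for every [f x], and summing over [x] would bound [drop] from
    below by the excluded value. *)
Lemma exists_sparse_level U (rho : R) :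
  drop < rho * \sum_(s in U) \sum_x f x s ->
  exists x, exists2 tau, 0 <= tau &
    #|out_edges U (level U (f x) tau)|%:R < rho * #|level U (f x) tau|%:R.
Proof.
move=> small; apply: contrapT => none; move: small; apply/negP; rewrite -leNgt.
rewrite exchange_big/= mulr_sumr; apply: ler_sum => x _.
apply: (@le_trans _ _ (\sum_(s in U) \sum_(u in U | G s u) Num.max 0 (f x s - f x u))).
  apply: coarea_le => // tau tau0; rewrite leNgt; apply/negP => lt.
  by apply: none; exists x, tau.
rewrite [leRHS](bigID (mem U))/= -[leLHS]addr0 lerD//; last first.
  by do 2!apply: sumr_ge0 => ? _; rewrite le_max lexx.
apply: ler_sum => s _; rewrite [leRHS](bigID (mem U))/= -[leLHS]addr0 lerD//.
  by rewrite le_eqVlt (eq_bigl _ _ (fun u => andbC _ _)) eqxx.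
by apply: sumr_ge0 => ? _; rewrite le_max lexx.
Qed.

Definition cross_edges (part : V -> {set V}) (A : {set V}) : {set V * V} :=
  [set e | [&& e.1 \in A, e.2 \in A, G e.1 e.2 & part e.1 != part e.2]].

(** Remove sparse level sets one after another until fewer than [m] vertices are left, which form
    [L]. Cutting off [C] costs fewer than [rho * #|C|] edges; the factor 2 counts both orientations.
    Strict positivity of [f x] on a piece remembers its seed [x]. *)
Lemma greedy_partition (rho m : R) : 0 <= rho -> 0 < m ->
  (forall U, m <= #|U|%:R -> drop < rho * \sum_(s in U) \sum_x f x s) ->
  forall U, exists (part : V -> {set V}) (L : {set V}),
    [/\ L \subset U, #|L|%:R < m,
        forall s, s \in U :\: L -> s \in part s /\
          exists x, forall v, v \in part s -> 0 < f x v &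
        #|cross_edges part (U :\: L)|%:R <= 2 * rho * #|U|%:R].
Proof.
move=> rho0 m0 small U; move: {2}#|U| (leqnn #|U|) => n.
elim: n U => [|n IH] U Un.
  exists (fun=> set0), set0; move: Un; rewrite leqn0 cards_eq0 => /eqP ->.
  split; rewrite ?sub0set ?cards0//.
  - by move=> s; rewrite !inE.
  - rewrite mulr0 (_ : cross_edges _ _ = set0) ?cards0//.
    by apply/setP => e; rewrite !inE.
have [Um|mU] := ltP (#|U|%:R : R) m.
  (* All remaining vertices go to [L], so the dummy piece [set0] is never looked up. *)
  exists (fun=> set0), U; split => //.
  - by move=> s; rewrite setDv inE.
  - rewrite (_ : cross_edges _ _ = set0) ?cards0; last first.
      by apply/setP => e; rewrite !inE eqxx !andbF.
    by rewrite !mulr_ge0.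
have [x [tau tau0]] := exists_sparse_level (small U mU).
set C := level U (f x) tau => sparse.
have CE s : (s \in C) = (s \in U) && (tau < f x s) by rewrite inE.
clearbody C.
have CU : C \subset U by apply/subsetP => s; rewrite CE => /andP[].
have C0 : (0 < #|C|)%N.
  rewrite lt0n; apply/eqP => C0; move: sparse.
  by rewrite C0 mulr0 ltNge ler0n.
have UC : (#|U :\: C| <= n)%N.
  by rewrite cardsD (setIidPr CU); move: Un C0 (subset_leq_card CU); lia.
have [part [L [LU Lm partP cross]]] := IH _ UC.
pose part' s := if s \in C then C else part s.
exists part', L; split => //.
- by apply: subset_trans LU (subsetDl _ _).
- move=> s; rewrite inE => /andP[sL sU]; rewrite /part'.
  have [sC|sC] := boolP (s \in C).
    split=> //; exists x => v; rewrite CE => /andP[_]; exact: le_lt_trans.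
  by apply: partP; rewrite !inE sL sC.
pose swap (e : V * V) := (e.2, e.1).
(* A cross edge leaves [C], enters [C], or already crosses in the rest. *)
have sub : cross_edges part' (U :\: L) \subset
    out_edges U C :|: (swap @: out_edges U C :|: cross_edges part (U :\: C :\: L)).
  apply/subsetP => -[s u]; rewrite !inE/= /part'.
  move=> /and4P[/andP[sL sU] /andP[uL uU] su]; rewrite sL sU uL uU su.
  case sC: (s \in C); case uC: (u \in C) => //=; rewrite ?eqxx//.
    move=> _; apply/orP; left; apply/imsetP; exists (u, s) => //.
    by rewrite !inE/= sC uC sU edge_sym su.
  by move=> ->; rewrite orbT.
have : (#|cross_edges part' (U :\: L)| <=
   #|out_edges U C| + (#|out_edges U C| + #|cross_edges part (U :\: C :\: L)|))%N.
  apply: leq_trans (subset_leq_card sub) _.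
  apply: leq_trans (leq_card_setU _ _) _; rewrite leq_add2l.
  apply: leq_trans (leq_card_setU _ _) _; rewrite leq_add2r.
  exact: leq_imset_card.
rewrite -(ler_nat R) !natrD => /le_trans; apply.
have -> : #|U|%:R = #|U :\: C|%:R + #|C|%:R :> R.
  by rewrite -natrD cardsD (setIidPr CU) subnK// subset_leq_card.
by move: cross sparse; lra.
Qed.

End Partition.

(** * Connectivity, and minors of a graph cut into pieces *)

Lemma connect_homo (T T' : finType) (e : rel T) (e' : rel T') (h : T -> T') x y :
  (forall u v, e u v -> e' (h u) (h v)) ->
  connect e x y -> connect e' (h x) (h y).
Proof.
move=> eh /connectP[p + ->]; elim: p x => [|u p IH] x /=; first by rewrite connect0.
by move=> /andP[xu /IH]; apply: connect_trans; apply/connect1/eh.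
Qed.

Lemma connect_invariant (T : finType) (K : Type) (e : rel T) (k : T -> K) x y :
  (forall u v, e u v -> k u = k v) -> connect e x y -> k x = k y.
Proof.
move=> ek /connectP[p + ->]; elim: p x => [|u p IH] x //=.
by move=> /andP[/ek -> /IH].
Qed.

Section Minors.
Variables (W : finType) (H : graph W).

(** Branch sets are pushed forward along [h]. Its properties are demanded only on [A], so that [h]
    may take arbitrary values elsewhere. *)
Lemma has_minor_image (V1 V2 : finType) (G1 : graph V1) (G2 : graph V2)
    (A : {set V1}) (h : V1 -> V2) (phi : W -> {set V1}) :
  {in A &, injective h} ->
  {in A &, forall u v, G1 u v -> G2 (h u) (h v)} ->
  (forall x, [/\ phi x != set0, phi x \subset A & connected_in G1 (phi x)]) ->
  (forall x y, x != y -> [disjoint phi x & phi y]) ->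
  (forall x y, H x y -> exists2 u, u \in phi x & exists2 v, v \in phi y & G1 u v) ->
  has_minor H G2.
Proof.
move=> h_inj h_edge phi1 phi_dis phi_adj.
have phiA x u : u \in phi x -> u \in A by case: (phi1 x) => _ /subsetP + _; apply.
apply/existsP; exists [ffun x => h @: phi x]; apply/and3P; split.
- apply/forallP => x; rewrite ffunE; case: (phi1 x) => phi0 _ conn.
  rewrite imset_eq0 phi0/=; apply/forall_inP => _ /imsetP[u ux ->].
  apply/forall_inP => _ /imsetP[v vx ->].
  have /forall_inP/(_ v vx) := forall_inP conn u ux.
  apply: connect_homo => a b /= /and3P[ax bx ab].
  by rewrite !imset_f//= h_edge// (phiA x).
- apply/forallP => x; apply/forallP => y; apply/implyP => xy.
  rewrite !ffunE -setI_eq0; apply/eqP/setP => w; rewrite !inE.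
  apply/negP => /andP[/imsetP[u ux ->] /imsetP[v vy]].
  move=> /(h_inj _ _ (phiA _ _ ux) (phiA _ _ vy)) uv.
  by move: (disjointFr (phi_dis x y xy) ux); rewrite uv vy.
- apply/forallP => x; apply/forallP => y; apply/implyP => /phi_adj[u ux [v vy uv]].
  rewrite !ffunE; apply/existsP; exists (h u); rewrite imset_f//=.
  by apply/existsP; exists (h v); rewrite imset_f//= h_edge//; [exact: phiA ux|exact: phiA vy].
Qed.

Lemma has_minorP (V : finType) (G : graph V) :
  has_minor H G -> exists phi : W -> {set V},
  [/\ forall x, phi x != set0 /\ connected_in G (phi x),
      forall x y, x != y -> [disjoint phi x & phi y] &
      forall x y, H x y -> exists2 u, u \in phi x & exists2 v, v \in phi y & G u v].
Proof.
move=> /existsP[phi /and3P[/forallP phi1 /forallP phi2 /forallP phi3]].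
exists phi; split.
- by move=> x; apply/andP; exact: phi1.
- by move=> x y; exact/implyP/(forallP (phi2 x)).
- move=> x y xy; have /existsP[u /andP[ux /existsP[v /andP[vy uv]]]] :=
    implyP (forallP (phi3 x) y) xy.
  by exists u => //; exists v.
Qed.

Lemma has_minor_induced (V : finType) (G : graph V) (A B : {set V}) :
  A \subset B -> has_minor H (induced G A) -> has_minor H (induced G B).
Proof.
move=> /subsetP AB /has_minorP[phi [phi1 phi2 phi3]].
pose h (u : {x | x \in A}) : {x | x \in B} := exist _ (val u) (AB _ (valP u)).
apply: (@has_minor_image _ _ (induced G A) _ setT h phi) => //.
- by move=> u v _ _ /(congr1 val)/= uv; apply/val_inj.
- by move=> x; case: (phi1 x); split=> //; exact: subsetT.
Qed.

Lemma connected_graphP x y : connected_graph H -> connect H x y.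
Proof.
move=> /forall_inP/(_ x (in_setT _))/forall_inP/(_ y (in_setT _)).
by apply: connect_sub => a b /and3P[_ _ ab]; exact: connect1.
Qed.

Lemma connected_graph_edge :
  connected_graph H -> (1 < #|W|)%N -> exists x y, H x y.
Proof.
move=> conH /card_gt1P[x [y [_ _ xy]]].
have /connectP[[|z p]] := connected_graphP x y conH.
  by move=> _ yx; rewrite yx eqxx in xy.
by move=> /= /andP[xz _] _; exists x, z.
Qed.

Section Pieces.
Variables (V : finType) (G : graph V) (part : V -> {set V}) (B : {set V}).

Definition piece_rel : rel V :=
  [rel u v | [&& G u v, u \notin B, v \notin B & part u == part v]].

Fact piece_sym : symmetric piece_rel.
Proof. by move=> u v; rewrite /piece_rel/= (edge_sym G) [in LHS]eq_sym; congr andb; rewrite andbCA. Qed.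

Fact piece_irrefl : irreflexive piece_rel.
Proof. by move=> u; rewrite /piece_rel/= (edge_irrefl G). Qed.

Definition piece_graph : graph V := Graph piece_sym piece_irrefl.

(** As [H] is connected, all branch sets lie in one component of the piece graph, hence in a single
    piece. An edge of [H] provides a starting vertex [u0] outside [B], since vertices of [B] are
    isolated there. *)
Lemma piece_graph_minor_free :
  connected_graph H -> (1 < #|W|)%N ->
  (forall s, s \notin B ->
     s \in part s /\ minor_free H (induced G (part s))) ->
  minor_free H piece_graph.
Proof.
move=> conH W1 partP; apply/negP => /has_minorP[phi [phi1 phi2 phi3]].
have [x0 [y0 xy0]] := connected_graph_edge conH W1.
have [u0 u0x [v0 v0y uv0]] := phi3 _ _ xy0.
have [_ u0B _ _] := and4P uv0.
have [u0C noC] := partP u0 u0B.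
pose good u := (u \notin B) && (part u == part u0).
have good_edge u v : piece_rel u v -> good u = good v.
  by rewrite /good => /and4P[_ -> -> /eqP ->].
have good_set x u v : u \in phi x -> v \in phi x -> good u = good v.
  move=> ux vx; case: (phi1 x) => _ /forall_inP/(_ u ux)/forall_inP/(_ v vx).
  by apply: connect_invariant => a b /and3P[_ _]; exact: good_edge.
have goodP x u : u \in phi x -> good u.
  pose k x := [forall v in phi x, good v].
  have k0 : k x0.
    by apply/forall_inP => v vx; rewrite (good_set _ _ _ vx u0x) /good u0B eqxx.
  have ke y z : H y z -> k y = k z.
    move=> /phi3[a ay [b bz /good_edge ab]].
    apply/forall_inP/forall_inP => ok v vy.
      by rewrite (good_set _ _ _ vy bz) -ab ok.
    by rewrite (good_set _ _ _ vy ay) ab ok.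
  move=> ux; have := connect_invariant ke (connected_graphP x0 x conH).
  by rewrite k0 => /esym/forall_inP; apply.
have goodC u : good u -> u \in part u0.
  by move=> /andP[uB /eqP <-]; case: (partP u uB).
(* Vertices outside [part u0] are sent to the default [u0]; none of them is good. *)
pose h u : {x | x \in part u0} := insubd (exist _ u0 u0C) u.
have hE u : good u -> val (h u) = u by move=> /goodC uC; rewrite val_insubd uC.
move/negP: noC; apply; apply: (@has_minor_image _ _ piece_graph _ [set u | good u] h phi) => //.
- by move=> u v; rewrite !inE => gu gv /(congr1 val); rewrite !hE.
- move=> u v; rewrite !inE => gu gv /and4P[uv _ _ _].
  by rewrite /= /induced_rel /= !hE.
- move=> x; case: (phi1 x) => ? ?; split=> //.
  by apply/subsetP => u /goodP; rewrite inE.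
Qed.

(** Edges are only deleted, and a deleted edge crosses between pieces or meets [B]. The sets [D1]
    and [D2] treat the two ends separately, whence the factor 2. *)
Lemma piece_edit_distance d : max_degree G = d ->
  (edit_distance G piece_graph <=
   #|cross_edges G part (~: B)| + 2 * d * #|B|)%N.
Proof.
move=> max_deg.
pose D1 := [set e : V * V | G e.1 e.2 & e.1 \in B].
pose D2 := [set e : V * V | G e.1 e.2 & e.2 \in B].
have D1B : (#|D1| <= d * #|B|)%N.
  rewrite -sum1_card (eq_bigl (fun e => (e.1 \in B) && G e.1 e.2)); last first.
    by move=> e; rewrite inE andbC.
  rewrite -(pair_big_dep (mem B) (fun u v => G u v) (fun _ _ => 1%N))/=.
  rewrite mulnC -sum_nat_const; apply: leq_sum => u _.
  rewrite sum1_card; apply: leq_trans (degree_le max_deg u).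
  by rewrite /degree cardsE.
have D2B : (#|D2| <= d * #|B|)%N.
  apply: leq_trans D1B; rewrite -(card_imset (mem D2) (f := fun e : V * V => (e.2, e.1))).
    apply/subset_leq_card/subsetP => _ /imsetP[e + ->].
    by rewrite !inE/= edge_sym.
  by move=> [a b] [a' b'] /= [-> ->].
pose edge_of (e : V * V) := [set e.1; e.2].
have sub : (edge_set G :\: edge_set piece_graph) :|:
      (edge_set piece_graph :\: edge_set G) \subset
    edge_of @: (cross_edges G part (~: B) :|: (D1 :|: D2)).
  apply/subsetP => e; rewrite !inE => /orP[|] /andP[].
    move=> nG'; case/existsP=> u /existsP[v /andP[/eqP eE uv]].
    apply/imsetP; exists (u, v) => //; rewrite !inE/= uv /=.
    apply: contraNT nG'; rewrite !negb_or negb_and => /and3P[].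
    move=> cr uB vB; apply/existsP; exists u; apply/existsP; exists v.
    by rewrite eE eqxx/= /piece_rel/= uv uB vB/=; move: cr; rewrite uB vB/= negbK.
  move=> nG; case/existsP=> u /existsP[v /andP[/eqP eE /and4P[uv _ _ _]]].
  by case/negP: nG; apply/existsP; exists u; apply/existsP; exists v; rewrite eE eqxx.
apply: leq_trans (subset_leq_card sub) _.
apply: leq_trans (leq_imset_card _ _) _.
apply: leq_trans (leq_card_setU _ _) _; rewrite leq_add2l.
apply: leq_trans (leq_card_setU _ _) _.
by move: D1B D2B; lia.
Qed.

End Pieces.
End Minors.

(** * Statistics of many independent walks from one vertex *)

Section Analysis.
Variables (R : realType) (V : finType) (G : graph V) (d : nat).
Hypothesis max_deg : max_degree G = d.
Hypothesis d_gt0 : (0 < d)%N.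

Local Notation dist := (walk_dist R G d).

Section Walks.
Variables (N n : nat) (s : V).

Definition walks_mass : {ffun 'I_N -> n.-tuple V} -> R :=
  prod_mass (fun p : n.-tuple V => walk_prob R d G s p).

Let mass_ge0 (p : n.-tuple V) : 0 <= walk_prob R d G s p.
Proof. exact: walk_prob_ge0. Qed.

Let mass_sum1 : \sum_(p : n.-tuple V) walk_prob R d G s p = 1.
Proof. exact: walk_prob_sum1. Qed.

Lemma walks_mass_ge0 c : 0 <= walks_mass c.
Proof. exact: prod_mass_ge0. Qed.

Lemma walks_mass_sum1 : \sum_c walks_mass c = 1.
Proof. exact: prod_mass_sum1. Qed.

Definition ends_at (v : V) (p : n.-tuple V) : R := (last s p == v)%:R.

Lemma expected_ends v :
  \sum_c walks_mass c * \sum_j ends_at v (c j) = N%:R * dist n s v.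
Proof.
under eq_bigr => c _ do rewrite mulr_sumr.
rewrite exchange_big/= (eq_bigr (fun=> dist n s v)); last first.
  move=> j _; rewrite (prod_expectation1 mass_sum1 j (ends_at v)).
  exact: walk_prob_last.
by rewrite sumr_const card_ord mulr_natl.
Qed.

(** For the number [X] of walks ending at [v], [X ^ 2 - X] counts ordered pairs of distinct walks
    ending there, and such pairs are independent. *)
Lemma expected_end_pairs v :
  \sum_c walks_mass c *
    ((\sum_j ends_at v (c j)) ^+ 2 - \sum_j ends_at v (c j)) <=
  (N%:R * dist n s v) ^+ 2.
Proof.
have pairs (c : {ffun 'I_N -> n.-tuple V}) :
    (\sum_j ends_at v (c j)) ^+ 2 - \sum_j ends_at v (c j) =
    \sum_j \sum_(k | j != k) ends_at v (c j) * ends_at v (c k).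
  rewrite expr2 big_distrl/= -sumrB; apply: eq_bigr => j _.
  rewrite big_distrr/= (bigD1 j)//= [X in X + _ - _](_ : _ = ends_at v (c j)).
    by rewrite addrAC subrr add0r; apply: eq_bigl => k; rewrite eq_sym.
  by rewrite /ends_at; case: eqP; rewrite ?mulr1 ?mulr0.
under eq_bigr => c _ do rewrite pairs mulr_sumr.
rewrite exchange_big/= exprMn [N%:R ^+ 2]expr2 -mulrA -[X in _ <= X * _](_ : \sum_(j < N) 1 = _); last first.
  by rewrite sumr_const card_ord.
rewrite mulr_suml; apply: ler_sum => j _; rewrite mul1r.
under eq_bigr => c _ do rewrite mulr_sumr.
rewrite exchange_big/= -[X in _ <= X * _](_ : \sum_(k < N) 1 = _); last first.
  by rewrite sumr_const card_ord.
rewrite mulr_suml big_mkcond/=; apply: ler_sum => k _; rewrite mul1r.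
case: ifP => [jk|_]; last exact: sqr_ge0.
rewrite (prod_expectation2 mass_sum1 (ends_at v) (ends_at v) jk) le_eqVlt.
by rewrite (walk_prob_last R G d_gt0) expr2 eqxx.
Qed.

(** Union bound over the vertices of [C]. *)
Lemma walks_miss (C : {set V}) (y : R) :
  (forall v, v \in C -> y <= \sum_(p : n.-tuple V | v \in s :: p) walk_prob R d G s p) ->
  0 <= y <= 1 ->
  \sum_(c : {ffun 'I_N -> n.-tuple V} | ~~ (C \subset [set v | [exists j, v \in s :: c j]])) walks_mass c <=
  #|C|%:R * (1 - y) ^+ N.
Proof.
move=> visit /andP[y0 y1].
pose miss v (c : {ffun 'I_N -> n.-tuple V}) := [forall j, v \notin s :: c j].
apply: (@le_trans _ _ (\sum_(v in C) \sum_(c | miss v c) walks_mass c)).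
  under [leRHS]eq_bigr => v _ do rewrite big_mkcond/=.
  rewrite exchange_big/= big_mkcond/=; apply: ler_sum => c _.
  case: ifP => [/subsetPn[v vC]|_]; last first.
    by apply: sumr_ge0 => v _; case: ifP; rewrite ?walks_mass_ge0.
  rewrite inE => /existsPn mv; rewrite (bigD1 v)//= ifT; last exact/forallP.
  by rewrite lerDl; apply: sumr_ge0 => u _; case: ifP; rewrite ?walks_mass_ge0.
rewrite -sum1_card natr_sum mulr_suml; apply: ler_sum => v vC; rewrite mul1r.
rewrite (prod_mass_avoid N mass_sum1 (fun p : n.-tuple V => v \in s :: p)).
apply: lerXn2r; rewrite ?nnegrE ?subr_ge0//; last by rewrite lerD2l lerN2 visit.
rewrite -[leRHS]mass_sum1 [leRHS](bigID (fun p : n.-tuple V => v \in s :: p))/= lerDl.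
exact: sumr_ge0.
Qed.

End Walks.

Lemma end_countE (l : nat) (s v : V) (c : @clip_walks V l) :
  (end_count s c v)%:R = \sum_j ends_at s v (c j).
Proof.
rewrite /end_count -sum1_card natr_sum big_mkcond/=; apply: eq_bigr => j _.
by rewrite inE /ends_at; case: eqP.
Qed.

Lemma heavy_setE (l : nat) (s v : V) (c : @clip_walks V l) :
  v \in heavy_set s c -> (l ^ 7 <= 2 * end_count s c v)%N.
Proof.
rewrite inE ler_pdivrMr// -natrM ler_nat.
by rewrite mulnC.
Qed.

Lemma estclip_highE (l : nat) (s : V) (c : @clip_walks V l) : estclip_high s c ->
  (l ^ 14 <= 3 * \sum_(v in heavy_set s c) end_count s c v)%N.
Proof. by rewrite /estclip_high ler_pdivrMr// -natrM ler_nat mulnC. Qed.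

(* Vertices of small walk probability rarely become heavy, by a bound on the
   number of pairs of walks ending at the same vertex. *)
Lemma estclip_high_excess (l : nat) (s : V) : (2 <= l)%N ->
  1 / 2 <= \sum_(c : @clip_walks V l | estclip_high s c) walks_mass s c ->
  1 / 24 <= \sum_v excess (1 / (96 * l%:R ^+ 7)) (dist l s v).
Proof.
move=> l2 high; set theta := 1 / (96 * l%:R ^+ 7).
have l0 : 0 < l%:R :> R by rewrite ltr0n; lia.
have l70 : 0 < l%:R ^+ 7 :> R by rewrite exprn_gt0.
have l74 : 4 <= l%:R ^+ 7 :> R.
  rewrite -natrX ler_nat; apply: (@leq_trans (2 ^ 7)%N) => //.
  by rewrite leq_exp2r.
have p0 v : 0 <= dist l s v by exact: walk_dist_ge0.
have tl : theta * l%:R ^+ 7 = 1 / 96.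
  by rewrite /theta; field; rewrite gt_eqF.
pose A := [set v | 2 * theta <= dist l s v].
pose cnt (c : @clip_walks V l) v : R := \sum_j ends_at s v (c j).
(* [X] dominates the number of walks ending at heavy vertices: off [A], a heavy [v] has count
   [k >= l ^ 7 / 2], so [4 * (k - 1) >= l ^ 7] and [k <= 4 / l ^ 7 * (k ^ 2 - k)]. *)
pose X c := \sum_(v in A) cnt c v +
  \sum_(v in ~: A) 4 / l%:R ^+ 7 * (cnt c v ^+ 2 - cnt c v).
have sq_ge (k : nat) : 0 <= k%:R ^+ 2 - k%:R :> R.
  by rewrite subr_ge0 -natrX ler_nat -mulnn; case: k => // k; exact: leq_pmulr.
have cnt_sq_ge c v : 0 <= cnt c v ^+ 2 - cnt c v.
  by rewrite /cnt -end_countE.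
have X_ge0 c : 0 <= X c.
  rewrite addr_ge0//; apply: sumr_ge0 => v _; first by rewrite /cnt -end_countE.
  by rewrite mulr_ge0// divr_ge0// ltW.
have X_high c : estclip_high s c -> l%:R ^+ 14 / 3 <= X c.
  move=> /estclip_highE; rewrite -(ler_nat R) natrM natr_sum natrX => hi.
  rewrite ler_pdivrMr// mulrC (le_trans hi)// ler_pM2l//.
  rewrite (bigID (mem A))/= lerD//.
    rewrite [leRHS](bigID (mem (heavy_set s c)))/= -[leLHS]addr0 lerD//.
      rewrite (eq_bigl _ _ (fun v => andbC _ _)) le_eqVlt; apply/orP; left.
      by apply/eqP/eq_bigr => v _; rewrite end_countE.
    by apply: sumr_ge0 => v _; rewrite /cnt -end_countE.
  rewrite [leRHS](bigID (mem (heavy_set s c)))/= -[leLHS]addr0 lerD//; last first.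
    by apply: sumr_ge0 => v _; rewrite mulr_ge0// divr_ge0// ltW.
  rewrite [leRHS](eq_bigl (fun v => (v \in heavy_set s c) && (v \notin A))); last first.
    by move=> v; rewrite !inE andbC.
  apply: ler_sum => v /andP[/heavy_setE]; rewrite -(ler_nat R) natrX natrM.
  rewrite end_countE -/(cnt c v); move: (cnt c v) => k hk _.
  rewrite mulrAC ler_pdivlMr//.
  have : 0 <= k * (4 * (k - 1) - l%:R ^+ 7) by apply: mulr_ge0; lra.
  by lra.
have EX_high : l%:R ^+ 14 / 6 <= \sum_c walks_mass s c * X c.
  apply: (@le_trans _ _ (\sum_(c | estclip_high s c) walks_mass s c * X c)); last first.
    rewrite [leRHS](bigID (@estclip_high _ l s))/= lerDl; apply: sumr_ge0 => c _.
    by rewrite mulr_ge0// walks_mass_ge0.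
  apply: (@le_trans _ _
     (\sum_(c : @clip_walks V l | estclip_high s c) walks_mass s c * (l%:R ^+ 14 / 3))).
    rewrite -mulr_suml; have := ler_wpM2r _ high; move/(_ (l%:R ^+ 14 / 3)).
    rewrite divr_ge0 ?exprn_ge0// => /(_ isT); lra.
  by apply: ler_sum => c hc; rewrite ler_wpM2l ?walks_mass_ge0// X_high.
have N14 : (l ^ 14)%:R = l%:R ^+ 14 :> R by rewrite natrX.
(* Off [A], [dist l s v < 2 * theta = 1 / (48 * l ^ 7)], and four times [l ^ 7] such probabilities
   give the factor [1 / 12]. *)
have EX : \sum_c walks_mass s c * X c <=
    l%:R ^+ 14 * (\sum_(v in A) dist l s v + 1 / 12).
  under eq_bigr => c _ do rewrite mulrDr 2!mulr_sumr.
  rewrite big_split/= exchange_big/= [X in _ + X]exchange_big/= mulrDr lerD//.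
    rewrite mulr_sumr; apply: ler_sum => v _.
    by rewrite /cnt expected_ends N14.
  apply: (@le_trans _ _ (\sum_(v in ~: A) l%:R ^+ 14 * (1 / 12 * dist l s v))).
    apply: ler_sum => v; rewrite !inE -ltNge => pv.
    under eq_bigr => c _ do rewrite mulrCA.
    rewrite -mulr_sumr; apply: (@le_trans _ _ (4 / l%:R ^+ 7 * (l%:R ^+ 14 * dist l s v) ^+ 2)).
      rewrite ler_wpM2l ?divr_ge0 ?(ltW l70)//.
      by rewrite -N14; exact: expected_end_pairs.
    have -> : 4 / l%:R ^+ 7 * (l%:R ^+ 14 * dist l s v) ^+ 2 =
       l%:R ^+ 14 * (dist l s v * (4 * (l%:R ^+ 7 * dist l s v))).
      by field; rewrite gt_eqF.
    rewrite ler_wpM2l ?exprn_ge0// [leRHS]mulrC ler_wpM2l//.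
    have := ler_wpM2l (ltW l70) (ltW pv); rewrite mulrCA [_ * theta]mulrC tl; lra.
  rewrite -!mulr_sumr ler_wpM2l ?exprn_ge0// ler_piMr ?divr_ge0// -[leRHS](walk_dist_sum1 R G d_gt0 l s).
  by rewrite [leRHS](bigID (mem (~: A)))/= lerDl; apply: sumr_ge0.
have pA : 1 / 12 <= \sum_(v in A) dist l s v.
  have := le_trans EX_high EX; rewrite ler_pM2l ?exprn_gt0//; lra.
(* On [A] the probability is at least [2 * theta], so clipping by [theta] keeps half of it. *)
apply: (@le_trans _ _ ((\sum_(v in A) dist l s v) / 2)); first by lra.
rewrite mulr_suml [leRHS](bigID (mem A))/= -[leLHS]addr0 lerD//; last first.
  by apply: sumr_ge0 => v _; exact: excess_ge0.
apply: ler_sum => v; rewrite inE => Av.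
by rewrite /excess le_max; apply/orP; right; lra.
Qed.

End Analysis.

(** * From one iteration to the whole run *)

Section Rejection.
Variables (R : realType) (V W : finType) (G : graph V) (H : graph W) (d l : nat).
Hypothesis max_deg : max_degree G = d.
Hypothesis d_gt0 : (0 < d)%N.
Hypothesis V_gt0 : (0 < #|V|)%N.

Local Notation mass := (walks_mass R G d).
Local Notation iter_prob := (@iteration_prob V d l G R).

Let nR : 0 < #|V|%:R :> R. Proof. by rewrite ltr0n. Qed.

(** Conditioned on the sampled vertex, the two families of walks are independent. *)
Lemma iteration_expectation (F : V -> @clip_walks V l -> R)
    (F' : V -> @search_walks V l -> R) :
  \sum_(x : @iteration V l) iter_prob x * (F x.1.1 x.1.2 * F' x.1.1 x.2) =
  #|V|%:R^-1 * \sum_s (\sum_c mass s c * F s c) * (\sum_b mass s b * F' s b).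
Proof.
rewrite mulr_sumr.
transitivity (\sum_s \sum_c \sum_b iter_prob (s, c, b) * (F s c * F' s b)).
  rewrite pair_bigA/= pair_bigA/=; apply: eq_bigr => -[[s c] b] _ //.
apply: eq_bigr => s _; rewrite mulr_suml mulr_sumr; apply: eq_bigr => c _.
rewrite mulr_sumr mulr_sumr; apply: eq_bigr => b _.
rewrite /iteration_prob /walks_mass /prod_mass; ring.
Qed.

Lemma iteration_prob_ge0 x : 0 <= iter_prob x.
Proof.
case: x => [[s c] b]; rewrite /iteration_prob !mulr_ge0 ?invr_ge0//.
- by apply: prodr_ge0 => j _; exact: walk_prob_ge0.
- by apply: prodr_ge0 => j _; exact: walk_prob_ge0.
Qed.

Lemma iteration_prob_clip (A : V -> pred (@clip_walks V l)) :
  \sum_(x : @iteration V l | A x.1.1 x.1.2) iter_prob x =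
  #|V|%:R^-1 * \sum_s \sum_(c | A s c) mass s c.
Proof.
transitivity (\sum_x iter_prob x * ((A x.1.1 x.1.2)%:R * 1)).
  rewrite big_mkcond/=; apply: eq_bigr => x _.
  by rewrite mulr1; case: ifP; rewrite ?mulr1 ?mulr0.
rewrite (iteration_expectation (fun s c => (A s c)%:R) (fun _ _ => 1)).
congr (_ * _); apply: eq_bigr => s _.
under [X in _ * X]eq_bigr => b _ do rewrite mulr1.
rewrite walks_mass_sum1// mulr1 [RHS]big_mkcond/=; apply: eq_bigr => c _.
by case: ifP; rewrite ?mulr1 ?mulr0.
Qed.

Lemma iteration_prob_search (A : V -> pred (@search_walks V l)) :
  \sum_(x : @iteration V l | A x.1.1 x.2) iter_prob x =
  #|V|%:R^-1 * \sum_s \sum_(b | A s b) mass s b.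
Proof.
transitivity (\sum_x iter_prob x * (1 * (A x.1.1 x.2)%:R)).
  rewrite big_mkcond/=; apply: eq_bigr => x _.
  by rewrite mul1r; case: ifP; rewrite ?mulr1 ?mulr0.
rewrite (iteration_expectation (fun _ _ => 1) (fun s b => (A s b)%:R)).
congr (_ * _); apply: eq_bigr => s _.
under [X in X * _]eq_bigr => c _ do rewrite mulr1.
rewrite walks_mass_sum1// mul1r [RHS]big_mkcond/=; apply: eq_bigr => b _.
by case: ifP; rewrite ?mulr1 ?mulr0.
Qed.

Lemma iteration_prob_sum1 : \sum_x iter_prob x = 1.
Proof.
rewrite (iteration_prob_clip (fun _ _ => true)).
under eq_bigr => s _ do rewrite walks_mass_sum1//.
by rewrite sumr_const mulVf// gt_eqF.
Qed.

Definition low (x : @iteration V l) := ~~ estclip_high x.1.1 x.1.2.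
Definition found (x : @iteration V l) := localsearch_found H G x.1.1 x.2.

Lemma rejectsE (w : @run V l) :
  rejects H G w = [exists i, found (w i)] || (2 * l ^ 20 < #|[set i | low (w i)]|)%N.
Proof.
rewrite /rejects; congr (_ || (_ < _))%N.
  by apply: eq_existsb => i; rewrite /found; case: (w i) => [[]].
by apply: eq_card => i; rewrite !inE /low; case: (w i) => [[]].
Qed.

Lemma reject_prob_ge (A : pred (@run V l)) :
  (forall w, ~~ rejects H G w -> A w) ->
  1 - \sum_(w | A w) prod_mass iter_prob w <= reject_prob d l H G R.
Proof.
move=> rejA; rewrite lerBlDr.
rewrite -(prod_mass_sum1 (l ^ 21) iteration_prob_sum1).
rewrite [leLHS](bigID (@rejects V W l H G))/= lerD2l.
rewrite big_mkcond [leRHS]big_mkcond/=; apply: ler_sum => w _.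
have [nr|_] := boolP (~~ _); first by rewrite rejA.
by case: ifP => // _; apply: prod_mass_ge0 => x; exact: iteration_prob_ge0.
Qed.

Lemma reject_many_low : (0 < l)%N ->
  30 / l%:R <= \sum_(x | low x) iter_prob x -> 2 / 3 <= reject_prob d l H G R.
Proof.
move=> l0; set q := \sum_(x | _) _ => q30.
have lR : 0 < l%:R :> R by rewrite ltr0n.
have q0 : 0 <= q by apply: sumr_ge0 => x _; exact: iteration_prob_ge0.
have q1 : q <= 1.
  rewrite -iteration_prob_sum1 [leRHS](bigID low)/= lerDl.
  by apply: sumr_ge0 => x _; exact: iteration_prob_ge0.
apply: le_trans (reject_prob_ge (A := fun w => #|[set i | low (w i)]| <= 2 * l ^ 20)%N _); last first.
  by move=> w; rewrite rejectsE negb_or -leqNgt => /andP[].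
have := prod_mass_few (l ^ 21) iteration_prob_ge0 iteration_prob_sum1 low (2 * l ^ 20).
rewrite -/q; set a := (1 - q / 2) ^+ l.
(* Grouping the iterations in blocks of [l] gives one factor [a <= 1 / 16] per block, which beats
   the factor [2 ^ 2]. *)
have -> : 2 ^+ (2 * l ^ 20) * (1 - q / 2) ^+ (l ^ 21) = (2 ^+ 2 * a) ^+ (l ^ 20) :> R.
  by rewrite (expnS l 20) exprM [(1 - _) ^+ _]exprM -exprMn.
have a0 : 0 <= a by apply: exprn_ge0; lra.
have a16 : a <= 1 / 16.
  have lq : 15 <= l%:R * (q / 2) by move: q30; rewrite ler_pdivrMr//; lra.
  have : a * 16 <= a * (1 + l%:R * (q / 2)) by rewrite ler_wpM2l//; lra.
  have : a * (1 + l%:R * (q / 2)) <= 1 by apply: expr_compl_le; lra.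
  by lra.
clearbody a.
have : (2 ^+ 2 * a) ^+ (l ^ 20) <= 1 / 4.
  have b4 : 2 ^+ 2 * a <= 1 / 4 by rewrite -natrX; lra.
  have b0 : 0 <= 2 ^+ 2 * a by rewrite mulr_ge0 ?exprn_ge0.
  apply: le_trans b4; rewrite -[leRHS]expr1 ler_wiXn2l//; last by rewrite expn_gt0 l0.
  by rewrite -natrX; lra.
by lra.
Qed.

Lemma reject_found : 2 <= (l ^ 21)%:R * \sum_(x | found x) iter_prob x ->
  2 / 3 <= reject_prob d l H G R.
Proof.
set q := \sum_(x | _) _ => q2.
have q0 : 0 <= q by apply: sumr_ge0 => x _; exact: iteration_prob_ge0.
have q1 : q <= 1.
  rewrite -iteration_prob_sum1 [leRHS](bigID found)/= lerDl.
  by apply: sumr_ge0 => x _; exact: iteration_prob_ge0.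
apply: le_trans (reject_prob_ge (A := fun w => [forall i, ~~ found (w i)]) _); last first.
  by move=> w; rewrite rejectsE negb_or negb_exists => /andP[].
rewrite (prod_mass_avoid _ iteration_prob_sum1 found) -/q.
have q01 : 0 <= q <= 1 by rewrite q0.
have := expr_compl_le (l ^ 21) q01; set a := (1 - q) ^+ _ => a1.
have a0 : 0 <= a by rewrite exprn_ge0// subr_ge0.
have : a * 3 <= a * (1 + (l ^ 21)%:R * q) by rewrite ler_wpM2l//; lra.
by lra.
Qed.

(** Markov's inequality: a vertex of this set is LOW with probability above 1/2. *)
Lemma few_low_vertices :
  \sum_(x | low x) iter_prob x < 30 / l%:R ->
  #|[set s | \sum_(c : @clip_walks V l | estclip_high s c) mass s c < 1 / 2]|%:R <=
  60 / l%:R * #|V|%:R :> R.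
Proof.
rewrite (iteration_prob_clip (fun s c => ~~ estclip_high s c)).
rewrite ltr_pdivrMl// => low30; set B := [set s | _].
have : \sum_(s in B) 1 / 2 <= \sum_s \sum_(c : @clip_walks V l | ~~ estclip_high s c) mass s c.
  rewrite [leRHS](bigID (mem B))/= -[leLHS]addr0 lerD//; last first.
    by do 2!apply: sumr_ge0 => ? _; exact: walks_mass_ge0.
  apply: ler_sum => s; rewrite inE => sB.
  have := walks_mass_sum1 R G d_gt0 (l ^ 14) l s.
  by rewrite (bigID (@estclip_high V l s))/=; lra.
rewrite sumr_const -[X in X <= _]mulr_natl.
by move: low30; lra.
Qed.

End Rejection.

(** * The number of entropy scales *)

Lemma linear_lt_exp2 (k : nat) : (12 <= k)%N -> (35 * k + 43 < 2 ^ k)%N.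
Proof.
move=> /subnK <-; elim: (k - 12)%N => [//|j IH].
by rewrite addSn expnS; move: IH; lia.
Qed.

(** The scales must reach 1 from [theta], yet [J] is only of order [log l]. Since
    [(eps ^ 4 * l) ^ 5 = eps ^ 20 * l * l ^ 4], the right-hand side is at least [l ^ (4 / 5)], which
    wins. *)
Lemma dyadic_scales (R : realType) (eps : R) (l : nat) :
  0 < eps -> 1 <= eps ^+ 20 * l%:R -> (60 <= trunc_log 2 l)%N ->
  exists J, 96 * l%:R ^+ 7 <= 2 ^+ J :> R /\ 2 ^+ 29 * J.+1%:R < eps ^+ 4 * l%:R.
Proof.
move=> eps0 eps_l; set k := trunc_log 2 l => k60.
have l0 : (0 < l)%N by move: k60; rewrite /k; case: (l).
have lR : 0 < l%:R :> R by rewrite ltr0n.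
have k_l : (2 ^ k <= l)%N by rewrite trunc_logP.
have l_k : (l < 2 ^ k.+1)%N by rewrite trunc_log_ltn.
clearbody k; pose q := (k %/ 5)%N.
have q12 : (12 <= q)%N by rewrite /q; lia.
have q_l : (2 ^ (5 * q) <= l)%N by apply: leq_trans k_l; rewrite leq_exp2l// /q; lia.
have l_q : (l <= 2 ^ (5 * q + 5))%N.
  by apply: leq_trans (ltnW l_k) _; rewrite leq_exp2l// /q; lia.
(* From [96 <= 2 ^ 7] and [l <= 2 ^ (5 * q + 5)]. *)
exists (35 * q + 42)%N; split.
  have -> : (35 * q + 42 = 7 + (5 * q + 5) * 7)%N by lia.
  rewrite exprD ler_pM ?exprn_ge0//; first by rewrite -natrX ler_nat.
  by rewrite exprM lerXn2r ?nnegrE ?exprn_ge0// -natrX ler_nat.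
have q4 : (2 ^+ 4) ^+ q <= eps ^+ 4 * l%:R.
  rewrite -(@ler_pXn2r _ 5%N)// ?nnegrE ?mulr_ge0 ?exprn_ge0 ?(ltW eps0) ?(ltW lR)//.
  have -> : (eps ^+ 4 * l%:R) ^+ 5 = eps ^+ 20 * l%:R * l%:R ^+ 4 by ring.
  apply: (@le_trans _ _ (l%:R ^+ 4)); last by rewrite ler_peMl// exprn_ge0// ltW.
  rewrite -!exprM (_ : (4 * q * 5 = 5 * q * 4)%N); last by lia.
  by rewrite exprM lerXn2r ?nnegrE ?exprn_ge0 ?(ltW lR)// -natrX ler_nat.
apply: lt_le_trans q4; rewrite -exprM.
apply: (@lt_le_trans _ _ (2 ^+ 29 * 2 ^+ q)).
  rewrite ltr_pM2l ?exprn_gt0// -natrX ltr_nat -addnS.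
  exact: linear_lt_exp2.
by rewrite -exprD ler_weXn2l ?ler1n//; lia.
Qed.

(** * Success of LocalSearch, and assembly of the bounds *)

Section Soundness.
Variables (R : realType) (V W : finType) (G : graph V) (H : graph W) (d l : nat).
Hypothesis max_deg : max_degree G = d.
Hypothesis d_gt0 : (0 < d)%N.
Hypothesis l_ge : (192 <= l)%N.

Local Notation dist := (walk_dist R G d).
Local Notation theta := (1 / (96 * l%:R ^+ 7) : R).

(* Any two vertices of a piece are joined through its seed [x] by a walk of
   length [2 t] with probability at least [theta ^ 2]. *)
Lemma localsearch_finds (t : nat) (x s : V) (C : {set V}) :
  (t < l)%N -> s \in C -> (forall v, v \in C -> theta < dist t x v) ->
  has_minor H (induced G C) ->
  1 / 2 <= \sum_(b : @search_walks V l | localsearch_found H G s b)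
             walks_mass R G d s b.
Proof.
move=> tl sC Cx minorC.
have l2 : (1 < l)%N by exact: leq_trans l_ge.
have lR : 0 < l%:R :> R by rewrite ltr0n; lia.
have l7 : 0 < l%:R ^+ 7 :> R by rewrite exprn_gt0.
have th0 : 0 < theta by rewrite divr_gt0// mulr_gt0.
have l1 : 1 <= l%:R :> R by rewrite ler1n; lia.
have th1 : theta <= 1.
  by rewrite ler_pdivrMr ?mulr_gt0// mul1r; have : 1 <= l%:R ^+ 7 :> R; [exact: exprn_ege1|lra].
(* The walk from [x] has total mass 1 and gives each vertex of [C] more than [theta]. *)
have C_le : #|C|%:R * theta <= 1.
  rewrite -[leRHS](walk_dist_sum1 R G d_gt0 t x) [leRHS](bigID (mem C))/=.
  rewrite -[leLHS]addr0 lerD//; last by apply: sumr_ge0 => v _; exact: walk_dist_ge0.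
  rewrite mulr_natl -sumr_const; apply: ler_sum => v vC; exact/ltW/Cx.
have visit v : v \in C -> theta ^+ 2 <=
    \sum_(p : (l ^ 11).-tuple V | v \in s :: p) walk_prob R d G s p.
  move=> vC; apply: le_trans (walk_prob_visit R max_deg d_gt0 (k := t + t) s v _).
    rewrite walk_distD (bigD1 x)//= -[leLHS]addr0 lerD//; last first.
      by apply: sumr_ge0 => u _; rewrite mulr_ge0 ?(walk_dist_ge0 R max_deg d_gt0).
    rewrite walk_dist_sym expr2; apply: ler_pM; [exact: ltW|exact: ltW| |]; exact/ltW/Cx.
  apply: (@leq_trans (l ^ 2)%N); last by rewrite leq_exp2l.
  by rewrite addnn -mul2n -mulnn leq_mul// ltnW.
have y01 : 0 <= theta ^+ 2 <= 1 by rewrite sqr_ge0 expr_le1// ltW.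
have := walks_miss max_deg d_gt0 (l ^ 21) visit y01.
(* The rational bound gives [a <= 96 ^ 2 / l ^ 6]. Of the miss probability [a ^ l] the square
   suffices: [#|C| * a ^ 2 <= 96 ^ 5 / l ^ 5 <= 1 / 2] as [l >= 192]. *)
set a := (1 - theta ^+ 2) ^+ (l ^ 20).
have a01 : 0 <= a <= 1.
  case/andP: y01 => y0 y1.
  by rewrite exprn_ge0 ?subr_ge0// exprn_ile1 ?subr_ge0// lerBlDr lerDl.
have a_le : a * l%:R ^+ 6 <= 96 ^+ 2.
  have := expr_compl_le (l ^ 20) y01; rewrite -/a => al.
  have : a * ((l ^ 20)%:R * theta ^+ 2) <= 1 by case/andP: a01 => a0 _; lra.
  have -> : (l ^ 20)%:R * theta ^+ 2 = l%:R ^+ 6 / 96 ^+ 2.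
    by rewrite natrX; field; rewrite gt_eqF.
  by rewrite mulrA ler_pdivrMr ?exprn_gt0// mul1r.
have aE : (1 - theta ^+ 2) ^+ (l ^ 21) = a ^+ l by rewrite /a -exprM -expnSr.
clearbody a.
have miss_le : #|C|%:R * (1 - theta ^+ 2) ^+ (l ^ 21) <= 1 / 2.
  case/andP: a01 => a0 a1; rewrite aE.
  have al2 : a ^+ l <= a ^+ 2 by exact: ler_wiXn2l.
  apply: (@le_trans _ _ (#|C|%:R * a ^+ 2)); first by rewrite ler_wpM2l.
  have C96 : #|C|%:R <= 96 * l%:R ^+ 7 :> R.
    by move: C_le; rewrite mulrA mulr1 ler_pdivrMr ?mulr_gt0// mul1r.
  have a2 : a ^+ 2 * l%:R ^+ 12 <= 96 ^+ 4.
    have -> : a ^+ 2 * l%:R ^+ 12 = (a * l%:R ^+ 6) ^+ 2 by ring.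
    rewrite [leRHS](exprM 96 2 2).
    by rewrite lerXn2r ?nnegrE ?mulr_ge0 ?exprn_ge0 ?(ltW lR).
  have l5 : 2 * 96 ^+ 5 <= l%:R ^+ 5 :> R.
    apply: (@le_trans _ _ ((2 * 96) ^+ 5)).
      by rewrite exprMn ler_wpM2r ?exprn_ge0// -[leLHS]expr1 ler_weXn2l// ler1n.
    by rewrite -natrM lerXn2r ?nnegrE ?ler0n// ler_nat.
  have l12 : 0 < l%:R ^+ 12 :> R by rewrite exprn_gt0.
  apply: (@le_trans _ _ (96 * l%:R ^+ 7 * a ^+ 2)); first by rewrite ler_wpM2r ?sqr_ge0.
  rewrite -(ler_pM2r l12).
  apply: (@le_trans _ _ (96 * l%:R ^+ 7 * 96 ^+ 4)).
    have c0 : 0 <= 96 * l%:R ^+ 7 :> R by rewrite mulr_ge0// ltW.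
    by have := ler_wpM2l c0 a2; rewrite mulrA.
  have -> : 1 / 2 * l%:R ^+ 12 = l%:R ^+ 7 * (l%:R ^+ 5 / 2) :> R by field.
  rewrite mulrAC -exprS mulrC.
  rewrite ler_pM2l//.
  by rewrite ler_pdivlMr// mulrC.
move=> /le_trans/(_ miss_le) miss.
have := walks_mass_sum1 R G d_gt0 (l ^ 21) (l ^ 11) s.
rewrite (bigID (fun b : @search_walks V l => C \subset encountered s b))/= => tot.
apply: (@le_trans _ _ (\sum_(b : @search_walks V l | C \subset encountered s b)
  walks_mass R G d s b)); first by move: miss tot; rewrite /encountered; lra.
rewrite big_mkcond [leRHS]big_mkcond/=; apply: ler_sum => b _.
case: ifP => [CB|_]; last by case: ifP; rewrite ?walks_mass_ge0.
by rewrite ifT//; exact: has_minor_induced CB minorC.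
Qed.

Lemma reject_far (eps : R) :
  0 < eps <= 1 / 2 -> 1 <= eps ^+ 20 * l%:R -> (60 <= trunc_log 2 l)%N ->
  connected_graph H -> (1 < #|W|)%N -> (0 < #|V|)%N ->
  far_from_minor_free eps d H G ->
  2 / 3 <= reject_prob d l H G R.
Proof.
move=> /andP[eps0 eps2] eps_l l60 conH W1 V0 far.
have lR : 0 < l%:R :> R by rewrite ltr0n; lia.
have l7 : 0 < l%:R ^+ 7 :> R by rewrite exprn_gt0.
have nR : 0 < #|V|%:R :> R by rewrite ltr0n.
have dR : 0 < d%:R :> R by rewrite ltr0n.
have th0 : 0 < theta by rewrite divr_gt0// mulr_gt0.
(* Ten of the twenty factors [eps] are bounded by [1 / 2], nine more by 1. *)
have eps_l1 : 2 ^+ 10 <= eps * l%:R.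
  have h0 : 0 < (1 / 2 : R) ^+ 10 by rewrite exprn_gt0 ?divr_gt0.
  rewrite -(ler_pM2l h0) -exprMn div1r mulVf ?pnatr_eq0// expr1n; apply: le_trans eps_l _.
  have -> : eps ^+ 20 * l%:R = eps ^+ 10 * (eps ^+ 9 * (eps * l%:R)) by ring.
  have el0 : 0 <= eps * l%:R by rewrite mulr_ge0 ?(ltW eps0) ?(ltW lR).
  rewrite -div1r ler_pM ?exprn_ge0 ?(ltW eps0)//; first by rewrite mulr_ge0 ?exprn_ge0 ?(ltW eps0).
    by rewrite lerXn2r ?nnegrE ?(ltW eps0) ?divr_ge0.
  by rewrite ler_piMl// exprn_ile1 ?(ltW eps0)//; lra.
have [q30|q30] := leP (30 / l%:R)
    (\sum_(x : @iteration V l | low x) iteration_prob d G R x).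
  by apply: reject_many_low q30 => //; exact: leq_trans l_ge.
set Bad := [set s | \sum_(c : @clip_walks V l | estclip_high s c)
  walks_mass R G d s c < 1 / 2].
have BadE : #|Bad|%:R <= 60 / l%:R * #|V|%:R :> R by exact: few_low_vertices.
have [J [J_ge J_lt]] := dyadic_scales eps0 eps_l l60.
(* With this [mu] both error terms of the variation are at most [eps ^ 2 / 2 ^ 13]; the exponent in
   [2 ^+ 29] is 2 + 13 + 14. *)
pose mu := eps ^+ 2 / 2 ^+ 14.
have mu0 : 0 < mu by rewrite divr_gt0 ?exprn_gt0.
have tJ : 1 <= theta * 2 ^+ J.
  by rewrite mulrAC ler_pdivlMr ?mulr_gt0// !mul1r.
have l_gt0 : (0 < l)%N by exact: leq_trans l_ge.
have [t tl drop_le] := exists_small_drop max_deg d_gt0 th0 mu0 tJ l_gt0.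
pose f x s := excess theta (dist t x s).
have f_ge0 x s : 0 <= f x s by exact: excess_ge0.
pose m := eps / 8 * #|V|%:R.
pose rho := eps / 8 * d%:R.
have m0 : 0 < m by rewrite mulr_gt0 ?divr_gt0.
have rho0 : 0 < rho by rewrite mulr_gt0 ?divr_gt0.
(* EstClip gives the bound at time [l]; by convexity the total excess was at least as large at the
   earlier time [t]. *)
have good s : s \notin Bad -> 1 / 24 <= \sum_x f x s.
  rewrite inE -leNgt => high.
  have l2 : (2 <= l)%N by exact: leq_trans l_ge.
  apply: le_trans (estclip_high_excess max_deg d_gt0 l2 high) _.
  under [leRHS]eq_bigr => x _ do rewrite /f walk_dist_sym.
  by apply: walk_dist_convex (ltnW tl) => //; exact: excess_tangents.
have drop_small : \sum_x total_drop G (f x) < d%:R * #|V|%:R * (eps ^+ 2 / 2 ^+ 12).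
  apply: le_lt_trans drop_le _; rewrite ltr_pM2l ?mulr_gt0//.
  have -> : eps ^+ 2 / 2 ^+ 12 = eps ^+ 2 / 2 ^+ 13 + 2 * mu by rewrite /mu; field.
  rewrite ltrD2r ltr_pdivrMr ?(mulr_gt0 mu0 lR)// /mu.
  have -> : eps ^+ 2 / 2 ^+ 13 * (eps ^+ 2 / 2 ^+ 14 * l%:R) =
    4 * (eps ^+ 4 * l%:R) / 2 ^+ 29 by field.
  by rewrite ltr_pdivlMr ?exprn_gt0// -mulrA ltr_pM2l// mulrC.
have sparse (U : {set V}) : m <= #|U|%:R ->
    \sum_x total_drop G (f x) < rho * \sum_(s in U) \sum_x f x s.
  move=> mU; apply: (lt_le_trans drop_small).
  have FU : (#|U|%:R - #|Bad|%:R) / 24 <= \sum_(s in U) \sum_x f x s.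
    apply: (@le_trans _ _ (\sum_(s in U :\: Bad) 1 / 24)).
      rewrite sumr_const -[leRHS]mulr_natr mulrAC ler_pM2r ?invr_gt0// mul1r.
      rewrite lerBlDr -natrD ler_nat -[leqLHS](cardsID Bad U) addnC leq_add2l.
      by rewrite subset_leq_card// subsetIr.
    rewrite [leRHS](bigID (mem Bad))/= -[leLHS]add0r lerD//.
      by do 2!apply: sumr_ge0 => ? _.
    rewrite (eq_bigl (fun s => (s \in U) && (s \notin Bad))); last first.
      by move=> s; rewrite in_setD andbC.
    by apply: ler_sum => s /andP[_]; exact: good.
  have Bm : #|Bad|%:R <= m / 2.
    apply: le_trans BadE _; rewrite /m [leRHS]mulrAC ler_pM2r//.
    by rewrite ler_pdivrMr//; move: eps_l1; rewrite -natrX; lra.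
  (* At least [m / 2] vertices of [U] are good. Then [rho * (m / 48)] carries the constant
     [1 / (8 * 8 * 48) = 1 / 3072], above [1 / 2 ^ 12]. *)
  have : m / 48 <= \sum_(s in U) \sum_x f x s by lra.
  rewrite -(ler_pM2l rho0); apply: le_trans.
  have -> : rho * (m / 48) = d%:R * #|V|%:R * (eps ^+ 2 / 3072) by rewrite /rho /m; field.
  rewrite ler_pM2l ?mulr_gt0// ler_pM2l ?exprn_gt0// lef_pV2 ?posrE ?exprn_gt0//.
  by rewrite -natrX ler_nat.
have [part [L [_ Lm partP cross]]] :=
  greedy_partition f_ge0 (ltW rho0) m0 sparse [set: V].
pose Z := [set s | (s \notin L) && has_minor H (induced G (part s))].
have partP' s : s \notin L -> s \in part s /\
    exists x, forall v, v \in part s -> theta < dist t x v.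
  move=> sL; have [|sp [x xP]] := partP s; first by rewrite !inE sL.
  by split=> //; exists x => v /xP; rewrite /f excess_gt0.
(* Isolating [L] and [Z] and cutting between pieces destroys all [H]-minors. Cross edges and [L]
   each account for at most a quarter of [eps * d * #|V|], so the edges at [Z], bounded by
   [2 * d * #|Z|], make up over half. *)
have Z_big : eps / 4 * #|V|%:R < #|Z|%:R.
  have free : minor_free H (piece_graph G part (L :|: Z)).
    apply: piece_graph_minor_free => // s; rewrite in_setU negb_or => /andP[sL].
    by rewrite inE sL/= => ?; case: (partP' s sL).
  have := far _ free.
  have := piece_edit_distance part (L :|: Z) max_deg; rewrite -(ler_nat R).
  move=> edit /lt_le_trans/(_ edit).
  have crossB : #|cross_edges G part (~: (L :|: Z))|%:R <= 2 * rho * #|V|%:R.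
    apply: le_trans (le_trans cross _); last by rewrite cardsT.
    rewrite ler_nat; apply/subset_leq_card/subsetP => e; rewrite !inE !negb_or.
    by move=> /and4P[/andP[-> _] /andP[-> _] -> ->].
  have LZ : #|L :|: Z|%:R <= #|L|%:R + #|Z|%:R :> R.
    by rewrite -natrD ler_nat leq_card_setU.
  rewrite natrD !natrM => far'.
  have : d%:R * (2 * #|L :|: Z|%:R) <= d%:R * (2 * (#|L|%:R + #|Z|%:R)) :> R.
    by rewrite ler_pM2l//; lra.
  have dL : d%:R * #|L|%:R < d%:R * m by rewrite ltr_pM2l.
  rewrite -(ltr_pM2l dR); move: far' crossB dL; rewrite /rho /m; lra.
apply: reject_found => //.
rewrite (iteration_prob_search R G d_gt0 (fun s b => localsearch_found H G s b)).
have : #|Z|%:R * (1 / 2) <=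
    \sum_s \sum_(b : @search_walks V l | localsearch_found H G s b) walks_mass R G d s b.
  rewrite mulr_natl -sumr_const [leRHS](bigID (mem Z))/= -[leLHS]addr0 lerD//.
    apply: ler_sum => s; rewrite inE => /andP[sL minor_s].
    by have [sp [x xP]] := partP' s sL; exact: localsearch_finds tl sp xP minor_s.
  by do 2!apply: sumr_ge0 => ? _; exact: walks_mass_ge0.
set S := \sum_s _ => ZS.
have nS : eps / 8 <= #|V|%:R^-1 * S.
  by rewrite ler_pdivlMl// mulrC; move: ZS Z_big; lra.
have l21 : 16 <= (l ^ 21)%:R * eps.
  rewrite natrX exprS mulrC mulrA -[leLHS]mulr1 ler_pM ?exprn_ege1 ?ler1n//.
  by move: eps_l1; rewrite -natrX; lra.
have : (l ^ 21)%:R * (eps / 8) <= (l ^ 21)%:R * (#|V|%:R^-1 * S) by rewrite ler_wpM2l.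
by lra.
Qed.

End Soundness.

Theorem theorem2p2 (R : realType) :
  exists2 alpha : nat, (0 < alpha)%N &
  forall (W : finType) (H : graph W) (r : nat) (eps : R)
         (V : finType) (G : graph V) (d l : nat),
    #|W| = r -> (3 <= r)%N -> connected_graph H ->
    0 < eps <= 1 / 2 ->
    l = walk_param alpha r eps ->
    max_degree G = d ->
    far_from_minor_free eps d H G ->
    2 / 3 <= reject_prob d l H G R.
Proof.
(* Chosen so that [trunc_log 2 l >= 60], as [dyadic_scales] requires. *)
exists (2 ^ 60)%N; first by rewrite expn_gt0.
move=> W H r eps V G d l Wr r3 conH eps_bd lE max_deg far.
have eps0 : 0 < eps by case/andP: eps_bd.
have W1 : (1 < #|W|)%N by rewrite Wr ltnW.
have l60 : (60 <= trunc_log 2 l)%N.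
  apply: trunc_log_max => //; rewrite lE /walk_param.
  by apply: leq_trans (leq_addr _ _); rewrite leq_pmulr// expn_gt0; case: (r) r3.
have l192 : (192 <= l)%N.
  have l0 : (0 < l)%N by case: (l) l60.
  apply: (@leq_trans (2 ^ 8)%N) => //.
  apply: (@leq_trans (2 ^ trunc_log 2 l)%N); last exact: trunc_logP.
  by rewrite leq_exp2l//; apply: leq_trans l60.
have eps_l : 1 <= eps ^+ 20 * l%:R.
  have e20 : 0 < eps ^+ 20 by rewrite exprn_gt0.
  rewrite -ler_pdivrMl// mulr1.
  have c0 : 0 <= Num.ceil (eps ^- 20) :> int.
    by rewrite ceil_ge0 (@lt_trans _ _ 0)// ?invr_gt0// ltrN10.
  apply: le_trans (ceil_ge _) _.
  rewrite lE /walk_param natrD natr_absz ger0_norm//.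
  by rewrite lerDr ler0n.
(* [G] itself has an [H]-minor, being at distance 0 from itself; an edge of [H] then yields an edge
   of [G], hence [d > 0]. *)
have [u [v uv]] : exists u v, G u v.
  have : has_minor H G.
    apply: contraT => no_minor; have := far G no_minor.
    by rewrite /edit_distance setDv setU0 cards0 ltNge !mulr_ge0// ltW.
  move=> /has_minorP[phi [_ _ adj]].
  have [x [y /adj[u _ [v _ uv]]]] := connected_graph_edge conH W1.
  by exists u, v.
have V0 : (0 < #|V|)%N by apply/card_gt0P; exists u.
have d0 : (0 < d)%N.
  apply: leq_trans (degree_le max_deg u); apply/card_gt0P; exists v.
  by rewrite inE.
by apply: (reject_far _ _ _ eps_bd).
Qed.
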